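(* Let $(R,m_R)$ be a Noetherian local ring of dimension $d$ and let $I_1,\dots,I_r,J_1,\dots,J_r$ be ideals of $R$ such that $I_i\subseteq J_i$ and $l_R(J_i/I_i)<\infty$ for all $i=1,\dots,r$. Then there exists a numerical polynomial $F\in\mathbb{Q}[n_1,\dots,n_r]$ of total degree at most $d$ such that $$l_R\left(\frac{J_1^{n_1}\cdots J_r^{n_r}}{I_1^{n_1}\cdots I_r^{n_r}}\right)=F(n_1,\dots,n_r)$$ for all $n_1,\dots,n_r\gg0$.
   Context: A numerical polynomial is a polynomial with rational coefficients taking integer values at integer points; $l_R$ denotes length. *)

(* Defs.v *)
From HB Require Import structures.
From mathcomp Require Import all_boot all_order all_algebra.
From mathcomp Require Import mpoly.
Set Implicit Arguments. Unset Strict Implicit. Unset Printing Implicit Defensive.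
Import Order.TTheory GRing.Theory Num.Theory.
Local Open Scope ring_scope.

Section CommAlg.
Variable R : comNzRingType.

Definition is_ideal (I : R -> Prop) : Prop :=
  I 0 /\ (forall x y, I x -> I y -> I (x + y)) /\ (forall a x, I x -> I (a * x)).

Definition sub_ideal (I J : R -> Prop) : Prop := forall x, I x -> J x.
Definition strict_sub (I J : R -> Prop) : Prop := sub_ideal I J /\ ~ sub_ideal J I.

Definition prime_ideal (P : R -> Prop) : Prop :=
  is_ideal P /\ ~ P 1 /\ (forall x y, P (x * y) -> P x \/ P y).

Definition maximal_ideal (M : R -> Prop) : Prop :=
  is_ideal M /\ ~ M 1 /\
  (forall J, is_ideal J -> sub_ideal M J -> J 1 \/ sub_ideal J M).

Definition local_ring : Prop :=
  exists m, maximal_ideal m /\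
    forall M, maximal_ideal M -> (forall x, M x <-> m x).

Definition noetherian : Prop :=
  forall I : nat -> R -> Prop,
    (forall n, is_ideal (I n)) -> (forall n, sub_ideal (I n) (I n.+1)) ->
    exists N, forall n, (N <= n)%N -> sub_ideal (I n) (I N).

Definition has_prime_chain (k : nat) : Prop :=
  exists P : nat -> R -> Prop,
    (forall i, (i <= k)%N -> prime_ideal (P i)) /\
    (forall i, (i < k)%N -> strict_sub (P i) (P i.+1)).

Definition krull_dim (d : nat) : Prop := has_prime_chain d /\ ~ has_prime_chain d.+1.

(* Length of the R-module J/I (I ⊆ J ideals): submodules of J/I correspond
   to ideals K with I ⊆ K ⊆ J; l_R(J/I) is the supremum of lengths of strict
   chains of such submodules. *)
Definition has_chain_between (I J : R -> Prop) (k : nat) : Prop :=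
  exists K : nat -> R -> Prop,
    (forall i, (i <= k)%N -> is_ideal (K i) /\ sub_ideal I (K i) /\ sub_ideal (K i) J) /\
    (forall i, (i < k)%N -> strict_sub (K i) (K i.+1)).

Definition length_eq (I J : R -> Prop) (l : nat) : Prop :=
  has_chain_between I J l /\ ~ has_chain_between I J l.+1.

Definition ideal_mul (I J : R -> Prop) : R -> Prop :=
  fun x => exists n (a b : 'I_n -> R),
    (forall i, I (a i)) /\ (forall i, J (b i)) /\ x = \sum_(i < n) a i * b i.

Definition unit_ideal : R -> Prop := fun _ => True.

Definition ideal_exp (I : R -> Prop) (n : nat) : R -> Prop :=
  iter n (ideal_mul I) unit_ideal.

Definition ideal_prod_exp (r : nat) (I : 'I_r -> R -> Prop) (n : 'I_r -> nat) : R -> Prop :=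
  foldr (fun i acc => ideal_mul (ideal_exp (I i) (n i)) acc) unit_ideal (enum 'I_r).

End CommAlg.

Definition numerical_poly (r : nat) (F : {mpoly rat[r]}) : Prop :=
  forall z : 'I_r -> int, F.@[fun i => (z i)%:~R] \is a Num.int.

(* Main.v *)
Require Import Defs.
From HB Require Import structures.
From mathcomp Require Import all_boot all_order all_algebra.
From mathcomp Require Import boolp classical_sets.
From mathcomp Require Import mpoly ring zify.
From mathcomp.real_closed Require Import polyrcf.
Import Order.TTheory GRing.Theory Num.Theory.
Local Open Scope ring_scope.
Set Implicit Arguments. Unset Strict Implicit. Unset Printing Implicit Defensive.

(** Let [z] run through generators of the ideals [J_i] and [y] through generators of the [I_i], and
    order the monomials in these generators by degree and then lexicographically, the [z] first.
    Then [J^n / I^n] is filtered by the monomials [mu] of multidegree [n] involving some [z], with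
    successive quotients [R / L_mu], where [L_mu] consists of the [c] such that [c mu] is a
    combination of smaller monomials of the same multidegree. Some power of the maximal ideal [m]
    lies in every [L_mu], so [R / L_mu] has finite length. Since [L_mu] increases with [mu] and [R]
    is Noetherian, [L_mu] only depends on [mu] truncated at some bound; hence the length of
    [J^n / I^n] is a sum of products of eventually polynomial functions of the single [n_i].

    These products take nonnegative values, so each has degree at most [d] as soon as the length
    is [O(s^d)] on the diagonal [n = (s, .., s)]. Put [A = J_1 .. J_r]. The same stability of
    leading coefficient ideals gives the linear Artin-Rees inclusion of
    [m^N] intersected with [A^s] in [m^(N - k s) A^s], whence [m^(c s)] intersected with [J^n] lies
    in [I^n] for some [c], and the length is at most that of [R / m^(c s)], which is [O(s^d)]
    because [R] has a parameter ideal with [d] generators. *)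

Create HintDb ideals.

(* Goals with evars are left alone, since any ideal in the context would instantiate them. *)
#[local] Hint Extern 0 (is_ideal ?I) =>
  tryif has_evar I then fail else solve [auto 8 with ideals nocore] : core.

(** * Ideals *)

Section Ideals.
Variable R : comNzRingType.
Implicit Types (A B C D K M S T : R -> Prop) (a b c x y : R).

Lemma ideal0 A : is_ideal A -> A 0. Proof. by case. Qed.

Lemma idealD A x y : is_ideal A -> A x -> A y -> A (x + y).
Proof. by case=> _ [closedD _]; apply: closedD. Qed.

Lemma idealMl A a x : is_ideal A -> A x -> A (a * x).
Proof. by case=> _ [_ closedM]; apply: closedM. Qed.

Lemma idealMr A a x : is_ideal A -> A x -> A (x * a).
Proof. by move=> idA; rewrite mulrC; apply: idealMl. Qed.

Lemma idealN A x : is_ideal A -> A x -> A (- x).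
Proof. by move=> idA; rewrite -mulN1r; apply: idealMl. Qed.

Lemma idealB A x y : is_ideal A -> A x -> A y -> A (x - y).
Proof. by move=> idA Ax Ay; apply: idealD => //; apply: idealN. Qed.

Lemma eq_unit_ideal A : is_ideal A -> A 1 -> A = @unit_ideal R.
Proof.
move=> idA A1; apply/seteqP; split=> // x _.
by rewrite -[x]mulr1; apply: idealMl.
Qed.

Lemma sub_ideal_refl A : sub_ideal A A. Proof. by []. Qed.

Lemma sub_ideal_trans A B C : sub_ideal A B -> sub_ideal B C -> sub_ideal A C.
Proof. exact: subset_trans. Qed.

Lemma not_sub_ideal A B : ~ sub_ideal A B -> exists2 x, A x & ~ B x.
Proof. by move=> /existsNP[x /not_implyP[Ax nBx]]; exists x. Qed.

Lemma unit_is_ideal : is_ideal (@unit_ideal R). Proof. by []. Qed.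

Lemma sub_unit_ideal A : sub_ideal A (@unit_ideal R). Proof. by []. Qed.

Definition colon B a : R -> Prop := fun c => B (c * a).

Lemma colon_is_ideal B a : is_ideal B -> is_ideal (colon B a).
Proof.
move=> idB; rewrite /colon; split; first by rewrite mul0r; apply: ideal0.
split=> [x y Bx By|c x Bx]; first by rewrite mulrDl; apply: idealD.
by rewrite -mulrA; apply: idealMl.
Qed.

Inductive ideal_span S : R -> Prop :=
| span0 : ideal_span S 0
| spanMD a x y : S x -> ideal_span S y -> ideal_span S (a * x + y).

Lemma span_is_ideal S : is_ideal (ideal_span S).
Proof.
split; first exact: span0.
split=> [x y + Sy|c x]; elim=> [|a u v Su _ IH].
- by rewrite add0r.
- by rewrite -addrA; apply: spanMD.
- by rewrite mulr0; apply: span0.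
- by rewrite mulrDr mulrA; apply: spanMD.
Qed.

#[local] Hint Resolve unit_is_ideal colon_is_ideal span_is_ideal : ideals.

Lemma mem_span S x : S x -> ideal_span S x.
Proof.
by move=> Sx; rewrite -[x]mul1r -[_ * _]addr0; apply: spanMD => //; apply: span0.
Qed.

Lemma span_min S K : is_ideal K -> (forall x, S x -> K x) ->
  sub_ideal (ideal_span S) K.
Proof.
move=> idK SK x; elim=> [|a u v Su _ IH]; first exact: ideal0.
by apply: idealD => //; apply: idealMl => //; apply: SK.
Qed.

Lemma span_mono S T : (forall x, S x -> T x) ->
  sub_ideal (ideal_span S) (ideal_span T).
Proof.
by move=> ST; apply: span_min => // x /ST; apply: mem_span.
Qed.

Lemma ideal_mul_min A B K : is_ideal K ->
  (forall a b, A a -> B b -> K (a * b)) -> sub_ideal (ideal_mul A B) K.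
Proof.
move=> idK ABK _ [n [a [b [Aa [Bb ->]]]]].
by apply: big_ind => [|x y|i _]; [apply: ideal0 | apply: idealD | apply: ABK].
Qed.

Lemma mem_ideal_mul A B a b : A a -> B b -> ideal_mul A B (a * b).
Proof.
by move=> Aa Bb; exists 1%N, (fun=> a), (fun=> b); rewrite big_ord1.
Qed.

Lemma ideal_mul_span A B : is_ideal A ->
  ideal_mul A B = ideal_span (fun x => exists a b, [/\ A a, B b & x = a * b]).
Proof.
move=> idA; apply/seteqP; split.
  by apply: ideal_mul_min => // a b Aa Bb; apply: mem_span; exists a, b.
move=> x; elim=> [|c u v [a [b [Aa Bb ->]]] _ [n [f [g [Af [Bg ->]]]]]].
  by exists 0%N, (fun=> 0), (fun=> 0); rewrite big_ord0; do 2!split=> [[]|] //.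
exists n.+1, (fun i => oapp f (c * a) (unlift ord0 i)),
  (fun i => oapp g b (unlift ord0 i)).
split=> [i|]; first by case: (unlift ord0 i) => /=; last exact: idealMl.
split=> [i|]; first by case: (unlift ord0 i).
rewrite big_ord_recl unlift_none mulrA; congr (_ + _).
by apply: eq_bigr => i _; rewrite liftK.
Qed.

Lemma span_mul_min S T K : is_ideal K -> (forall x y, S x -> T y -> K (x * y)) ->
  sub_ideal (ideal_mul (ideal_span S) (ideal_span T)) K.
Proof.
move=> idK STK; apply: ideal_mul_min => // a b + Tb.
suff: sub_ideal (ideal_span S) (colon K b) by apply.
apply: span_min => // x Sx.
suff: sub_ideal (ideal_span T) (colon K x) by rewrite /colon mulrC; apply.
by apply: span_min => // y Ty; rewrite /colon mulrC; apply: STK.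
Qed.

Lemma mul_is_ideal A B : is_ideal A -> is_ideal (ideal_mul A B).
Proof. by move=> idA; rewrite ideal_mul_span. Qed.

Lemma ideal_mul_mono A B C D : sub_ideal A C -> sub_ideal B D ->
  sub_ideal (ideal_mul A B) (ideal_mul C D).
Proof.
move=> AC BD x [n [a [b [Aa [Bb ->]]]]]; exists n, a, b.
by split=> [i|]; [apply: AC | split=> // i; apply: BD].
Qed.

Lemma ideal_mul_subl A B : is_ideal A -> sub_ideal (ideal_mul A B) A.
Proof. by move=> idA; apply: ideal_mul_min => // a b Aa _; apply: idealMr. Qed.

Lemma ideal_mul_subr A B : is_ideal B -> sub_ideal (ideal_mul A B) B.
Proof. by move=> idB; apply: ideal_mul_min => // a b _; apply: idealMl. Qed.

Lemma ideal_mulC A B : ideal_mul A B = ideal_mul B A.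
Proof.
apply/seteqP; split=> _ [n [a [b [Aa [Bb ->]]]]]; exists n, b, a;
  by do 2!split=> //; apply: eq_bigr => i _; rewrite mulrC.
Qed.

#[local] Hint Resolve mul_is_ideal : ideals.

Lemma ideal_mulA A B C : is_ideal A ->
  ideal_mul A (ideal_mul B C) = ideal_mul (ideal_mul A B) C.
Proof.
move=> idA; apply/seteqP; split; apply: ideal_mul_min => //.
- move=> a x Aa; suff: sub_ideal (ideal_mul B C) (colon (ideal_mul (ideal_mul A B) C) a).
    by rewrite mulrC; apply.
  apply: ideal_mul_min => // b c Bb Cc.
  by rewrite /colon mulrC mulrA; do 2?apply: mem_ideal_mul.
- move=> x c + Cc; suff: sub_ideal (ideal_mul A B) (colon (ideal_mul A (ideal_mul B C)) c).
    by apply.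
  apply: ideal_mul_min => // a b Aa Bb.
  by rewrite /colon -mulrA; do 2?apply: mem_ideal_mul.
Qed.

Lemma ideal_mul1 A : is_ideal A -> ideal_mul (@unit_ideal R) A = A.
Proof.
move=> idA; apply/seteqP; split=> [|x Ax]; first exact: ideal_mul_subr.
by rewrite -[x]mul1r; apply: mem_ideal_mul.
Qed.

Lemma ideal_mulACA A B C D :
  is_ideal A -> is_ideal B -> is_ideal C ->
  ideal_mul (ideal_mul A B) (ideal_mul C D) = ideal_mul (ideal_mul A C) (ideal_mul B D).
Proof.
move=> idA idB idC; rewrite -!ideal_mulA //.
by rewrite (ideal_mulA C D idB) (ideal_mulC B) -(ideal_mulA B D idC).
Qed.

Lemma ideal_expS A n : ideal_exp A n.+1 = ideal_mul A (ideal_exp A n).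
Proof. by []. Qed.

Lemma exp_is_ideal A n : is_ideal A -> is_ideal (ideal_exp A n).
Proof. by case: n => // n idA; rewrite ideal_expS. Qed.

#[local] Hint Resolve exp_is_ideal : ideals.

Lemma ideal_expD A m n : is_ideal A ->
  ideal_exp A (m + n) = ideal_mul (ideal_exp A m) (ideal_exp A n).
Proof.
move=> idA; elim: m => [|m IH]; first by rewrite ideal_mul1.
by rewrite addSn !ideal_expS IH ideal_mulA.
Qed.

Lemma ideal_expMn A B n : is_ideal A -> is_ideal B ->
  ideal_exp (ideal_mul A B) n = ideal_mul (ideal_exp A n) (ideal_exp B n).
Proof.
move=> idA idB; elim: n => [|n IH]; first by rewrite ideal_mul1.
by rewrite !ideal_expS IH ideal_mulACA.
Qed.

Lemma ideal_expM A m n : is_ideal A ->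
  ideal_exp A (m * n) = ideal_exp (ideal_exp A m) n.
Proof.
move=> idA; elim: n => [|n IH]; first by rewrite muln0.
by rewrite mulnS ideal_expD // IH.
Qed.

Lemma ideal_exp_unit n : ideal_exp (@unit_ideal R) n = @unit_ideal R.
Proof. by elim: n => // n IH; rewrite ideal_expS IH ideal_mul1. Qed.

Lemma ideal_exp_mono A B n : sub_ideal A B ->
  sub_ideal (ideal_exp A n) (ideal_exp B n).
Proof. by move=> AB; elim: n => // n IH; apply: ideal_mul_mono. Qed.

Lemma ideal_exp_anti A m n : is_ideal A -> (m <= n)%N ->
  sub_ideal (ideal_exp A n) (ideal_exp A m).
Proof. by move=> idA /subnKC <-; rewrite ideal_expD //; apply: ideal_mul_subl. Qed.

Lemma mem_ideal_exp A x n : A x -> ideal_exp A n (x ^+ n).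
Proof. by move=> Ax; elim: n => // n IH; rewrite exprS; apply: mem_ideal_mul. Qed.

Definition ideal_add A B : R -> Prop := fun x => exists a b, [/\ A a, B b & x = a + b].

Lemma add_is_ideal A B : is_ideal A -> is_ideal B -> is_ideal (ideal_add A B).
Proof.
move=> idA idB; split; first by exists 0, 0; rewrite addr0; split=> //; apply: ideal0.
split=> [_ _ [a [b [Aa Bb ->]]] [a' [b' [Aa' Bb' ->]]]|c _ [a [b [Aa Bb ->]]]].
- by exists (a + a'), (b + b'); rewrite addrACA; split=> //; apply: idealD.
- by exists (c * a), (c * b); rewrite mulrDr; split=> //; apply: idealMl.
Qed.

Lemma ideal_add_subl A B : is_ideal B -> sub_ideal A (ideal_add A B).
Proof. by move=> idB x Ax; exists x, 0; rewrite addr0; split=> //; apply: ideal0. Qed.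

Lemma ideal_add_subr A B : is_ideal A -> sub_ideal B (ideal_add A B).
Proof. by move=> idA x Bx; exists 0, x; rewrite add0r; split=> //; apply: ideal0. Qed.

Lemma ideal_add_min A B K : is_ideal K -> sub_ideal A K -> sub_ideal B K ->
  sub_ideal (ideal_add A B) K.
Proof. by move=> idK AK BK _ [a [b [/AK Ka /BK Kb ->]]]; apply: idealD. Qed.

Lemma ideal_add_mono A B C D : sub_ideal A C -> sub_ideal B D ->
  sub_ideal (ideal_add A B) (ideal_add C D).
Proof. by move=> AC BD _ [a [b [/AC Ca /BD Db ->]]]; exists a, b. Qed.

Lemma ideal_addA A B C : ideal_add A (ideal_add B C) = ideal_add (ideal_add A B) C.
Proof.
apply/seteqP; split=> [_ [a [_ [Aa [b [c [Bb Cc ->]]] ->]]]|_ [_ [c [[a [b [Aa Bb ->]]] Cc ->]]]].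
  by exists (a + b), c; rewrite addrA; split=> //; exists a, b.
by exists a, (b + c); rewrite -addrA; split=> //; exists b, c.
Qed.

Lemma ideal_addAC A B C : ideal_add (ideal_add A B) C = ideal_add (ideal_add A C) B.
Proof.
apply/seteqP; split=> _ [_ [c [[a [b [Aa Bb ->]]] Cc ->]]];
  by exists (a + c), b; rewrite addrAC; split=> //; exists a, c.
Qed.

Lemma setI_is_ideal A B : is_ideal A -> is_ideal B -> is_ideal (A `&` B)%classic.
Proof.
move=> idA idB; split; first by split; apply: ideal0.
by split=> [x y [Ax Bx] [Ay By]|c x [Ax Bx]]; split;
  do [apply: idealD | apply: idealMl].
Qed.

Lemma modular_sub_ideal K A M : is_ideal K -> is_ideal A -> sub_ideal K A ->
  sub_ideal A (ideal_add K M) -> sub_ideal (A `&` M)%classic K -> sub_ideal A K.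
Proof.
move=> idK idA KA AKM AMK x Ax; have [y [z [Ky Mz xE]]] := AKM x Ax.
rewrite xE; apply: idealD => //; apply: AMK; split=> //.
by have -> : z = x - y by [rewrite xE addrC addKr]; apply: idealB => //; apply: KA.
Qed.

Definition ideal_scale A a : R -> Prop := fun x => exists2 c, A c & x = c * a.

Lemma scale_is_ideal A a : is_ideal A -> is_ideal (ideal_scale A a).
Proof.
move=> idA; split; first by exists 0; rewrite ?mul0r //; apply: ideal0.
split=> [_ _ [c Ac ->] [d Ad ->]|b _ [c Ac ->]].
- by exists (c + d); rewrite ?mulrDl //; apply: idealD.
- by exists (b * c); rewrite ?mulrA //; apply: idealMl.
Qed.

Definition adjoin A a := ideal_add A (ideal_scale (@unit_ideal R) a).

#[local] Hint Resolve add_is_ideal scale_is_ideal : ideals.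

Lemma adjoin_is_ideal A a : is_ideal A -> is_ideal (adjoin A a).
Proof. by move=> idA; rewrite /adjoin. Qed.

Lemma sub_adjoin A a : sub_ideal A (adjoin A a).
Proof. exact: ideal_add_subl. Qed.

Lemma mem_adjoin A a : is_ideal A -> adjoin A a a.
Proof. by move=> idA; apply: ideal_add_subr => //; exists 1; rewrite ?mul1r. Qed.

Lemma adjoin_min A a K : is_ideal K -> sub_ideal A K -> K a -> sub_ideal (adjoin A a) K.
Proof. by move=> idK AK Ka; apply: ideal_add_min => // _ [c _ ->]; apply: idealMl. Qed.

Lemma strict_sub_adjoin A a : is_ideal A -> ~ A a -> strict_sub A (adjoin A a).
Proof.
by move=> idA nAa; split=> [|AaA]; [apply: sub_adjoin | apply/nAa/AaA/mem_adjoin].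
Qed.

Definition seq_ideal (s : seq R) : R -> Prop := ideal_span (fun x => x \in s).

Lemma seq_is_ideal s : is_ideal (seq_ideal s). Proof. exact: span_is_ideal. Qed.

#[local] Hint Resolve adjoin_is_ideal seq_is_ideal : ideals.

Lemma seq_ideal_cons x s : seq_ideal (x :: s) = adjoin (seq_ideal s) x.
Proof.
apply/seteqP; split; [apply: span_min | apply: adjoin_min] => //.
- move=> y; rewrite inE => /predU1P[->|ys]; first exact: mem_adjoin.
  by apply: sub_adjoin; apply: mem_span.
- by apply: span_mono => y ys; rewrite inE ys orbT.
- exact/mem_span/mem_head.
Qed.

End Ideals.

#[local] Hint Resolve sub_ideal_refl sub_unit_ideal : core.
#[local] Hint Resolve unit_is_ideal colon_is_ideal span_is_ideal mul_is_ideal exp_is_ideal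
  add_is_ideal setI_is_ideal scale_is_ideal adjoin_is_ideal seq_is_ideal : ideals.

(** * Length *)

Section Length.
Variable R : comNzRingType.
Implicit Types (A B I J K L M : R -> Prop) (a b c x y : R) (k l : nat).

Definition ideal_between I J K := is_ideal K /\ sub_ideal I K /\ sub_ideal K J.

Definition length_le I J k := ~ has_chain_between I J k.+1.

Definition colength_le I k := length_le I (@unit_ideal R) k.

Lemma has_chain_rcons I J K L k :
  has_chain_between I K k -> is_ideal L -> strict_sub K L -> sub_ideal L J ->
  has_chain_between I J k.+1.
Proof.
move=> [C [Cbetween Cstrict]] idL [KL nLK] LJ.
have [_ [ICk CkK]] := Cbetween k (leqnn k).
exists (fun i => if (i <= k)%N then C i else L); split=> i.
- case: (leqP i k) => [/Cbetween[idCi [ICi CiK]] _|_ _].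
    by do 2!split=> //; apply: sub_ideal_trans CiK (sub_ideal_trans KL LJ).
  by do 2!split=> //; apply: sub_ideal_trans ICk (sub_ideal_trans CkK KL).
- move=> ik1; have [ik|ki] := ltnP i k; first by rewrite (ltnW ik); apply: Cstrict.
  have -> : i = k by apply/eqP; rewrite eqn_leq ki andbT.
  rewrite leqnn; split; first exact: sub_ideal_trans CkK KL.
  by move=> LCk; apply: nLK; apply: sub_ideal_trans LCk CkK.
Qed.

Lemma has_chain_belast I J k : has_chain_between I J k.+1 ->
  exists K L, [/\ ideal_between I J K, ideal_between I J L,
                  has_chain_between I K k & strict_sub K L].
Proof.
move=> [C [Cbetween Cstrict]].
have Cmono i j : (i <= j <= k)%N -> sub_ideal (C i) (C j).
  case/andP; elim: j => [|j IH]; first by rewrite leqn0 => /eqP->.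
  rewrite leq_eqVlt => /predU1P[->//|ij] jk; apply: sub_ideal_trans (IH ij (ltnW jk)) _.
  by case: (Cstrict j (ltnW jk)).
exists (C k), (C k.+1); split; [exact: Cbetween | exact: Cbetween | | exact: Cstrict].
exists C; split=> i ik; last exact/Cstrict/ltnW.
have [idCi [ICi _]] := Cbetween i (leqW ik).
by do 2!split=> //; apply: Cmono; rewrite ik leqnn.
Qed.

Lemma has_chain_mono I J I' J' k : sub_ideal I' I -> sub_ideal J J' ->
  has_chain_between I J k -> has_chain_between I' J' k.
Proof.
move=> II JJ [C [Cbetween Cstrict]]; exists C; split=> // i /Cbetween[idCi [ICi CiJ]].
by do 2!split=> //; [apply: sub_ideal_trans II ICi | apply: sub_ideal_trans CiJ JJ].
Qed.

Lemma has_chain_leq I J k l : (l <= k)%N ->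
  has_chain_between I J k -> has_chain_between I J l.
Proof.
move=> lk [C [Cbetween Cstrict]].
by exists C; split=> i il; [apply: Cbetween | apply: Cstrict]; apply: leq_trans lk.
Qed.

Lemma has_chain_refl I J : is_ideal I -> sub_ideal I J -> has_chain_between I J 0.
Proof. by move=> idI IJ; exists (fun=> I). Qed.

Lemma has_chain_strict I J : is_ideal I -> is_ideal J -> strict_sub I J ->
  has_chain_between I J 1.
Proof. by move=> idI idJ IJ; apply: (@has_chain_rcons _ _ I J) => //; apply: has_chain_refl. Qed.

Lemma has_chain_cat I K J k l :
  has_chain_between I K k -> has_chain_between K J l -> has_chain_between I J (k + l).
Proof.
move=> IKk; elim: l J => [|l IH] J.
  rewrite addn0 => -[C [/(_ 0%N (leqnn _))[_ [KC CJ]] _]].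
  exact: has_chain_mono (sub_ideal_trans KC CJ) IKk.
move=> /has_chain_belast[L [L' [[_ [_ _]] [idL' [_ L'J]] KLl LL']]]; rewrite addnS.
exact: has_chain_rcons (IH L KLl) idL' LL' L'J.
Qed.

Lemma length_le_mono I J I' J' k : sub_ideal I I' -> sub_ideal J' J ->
  length_le I J k -> length_le I' J' k.
Proof. by move=> II JJ lenIJ /(has_chain_mono II JJ). Qed.

Lemma has_chain_length_le I J k l : has_chain_between I J k -> length_le I J l -> (k <= l)%N.
Proof. by move=> IJk lenIJ; rewrite leqNgt; apply/negP => /has_chain_leq/(_ IJk)/lenIJ. Qed.

Lemma length_le_refl I k : length_le I I k.
Proof.
move=> /has_chain_belast[K [L [[_ [IK _]] [_ [_ LI]] _ [_ nLK]]]].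
by apply: nLK; apply: sub_ideal_trans LI IK.
Qed.

Lemma length_le0 I J : is_ideal I -> is_ideal J -> sub_ideal I J ->
  length_le I J 0 -> sub_ideal J I.
Proof. by move=> idI idJ IJ lenIJ; apply: contrapT => nJI; apply/lenIJ/has_chain_strict. Qed.

Lemma length_le_length_eq I J k : is_ideal I -> sub_ideal I J -> length_le I J k ->
  exists l, length_eq I J l.
Proof.
move=> idI IJ; elim: k => [|k IH] lenIJ; first by exists 0%N; split=> //; apply: has_chain_refl.
by have [IJk|/IH//] := EM (has_chain_between I J k.+1); exists k.+1.
Qed.

(* Each step of a chain is strict after intersecting with [M] or after adding [M], by modularity. *)
Lemma has_chain_split I J M k : is_ideal I -> is_ideal M -> sub_ideal I M ->
  has_chain_between I J k -> exists a b : nat, [/\ (a + b)%N = k,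
    has_chain_between I (J `&` M)%classic a & has_chain_between M (ideal_add J M) b].
Proof.
move=> idI idM IM; elim: k J => [|k IH] J.
  move=> [C [/(_ 0%N (leqnn _))[_ [IC CJ]] _]]; have IJ := sub_ideal_trans IC CJ.
  exists 0%N, 0%N; split=> //; apply: has_chain_refl => //.
    by move=> x Ix; split; [apply: IJ | apply: IM].
  by move=> x Mx; exists 0, x; rewrite add0r; split=> //; exact: IJ (ideal0 idI).
move=> /has_chain_belast[K [L [[idK [IK KJ]] [idL [IL LJ]] IKk [KL nLK]]]].
have [a [b [abk IKMa MKMb]]] := IH K IKk.
have [LMK|nLMK] := EM (sub_ideal (L `&` M)%classic K).
- exists a, b.+1; split; [by rewrite addnS abk | |].
    by apply: has_chain_mono IKMa => // x [/KJ].
  apply: (@has_chain_rcons _ _ _ (ideal_add L M)) (MKMb) _ _ _ => //.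
    split=> [|LMKM]; first exact: ideal_add_mono.
    apply: nLK; apply: (@modular_sub_ideal _ K L M) => //.
    exact: sub_ideal_trans (ideal_add_subl idM) LMKM.
  exact: ideal_add_mono.
- exists a.+1, b; split; [by rewrite addSn abk | |].
    apply: (@has_chain_rcons _ _ _ (L `&` M)%classic) (IKMa) _ _ _ => //.
      by split=> [x [/KL]|LMKM] //; apply: nLMK => x /LMKM[].
    by move=> x [/LJ].
  by apply: has_chain_mono MKMb => //; apply: ideal_add_mono.
Qed.

Lemma length_leD I K J k l : is_ideal I -> is_ideal J -> is_ideal K ->
  sub_ideal I K -> sub_ideal K J ->
  length_le I K k -> length_le K J l -> length_le I J (k + l).
Proof.
move=> idI idJ idK IK KJ lenIK lenKJ /(has_chain_split idI idK IK)[a [b [abk IKa KJb]]].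
have ak : (a <= k)%N by apply: has_chain_length_le lenIK; apply: has_chain_mono IKa => // x [].
have bl : (b <= l)%N.
  by apply: has_chain_length_le lenKJ; apply: has_chain_mono KJb => //; apply: ideal_add_min.
by have := leq_add ak bl; rewrite abk ltnn.
Qed.

Lemma length_eqD I K J k l : is_ideal I -> is_ideal J -> is_ideal K ->
  sub_ideal I K -> sub_ideal K J ->
  length_eq I K k -> length_eq K J l -> length_eq I J (k + l).
Proof.
move=> idI idJ idK IK KJ [IKk lenIK] [KJl lenKJ]; split; first exact: has_chain_cat IKk KJl.
exact: length_leD lenIK lenKJ.
Qed.

Lemma has_chain_map (phi : (R -> Prop) -> R -> Prop) I J I' J' k :
  (forall K, ideal_between I J K -> ideal_between I' J' (phi K)) ->
  (forall K L, ideal_between I J K -> ideal_between I J L ->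
     strict_sub K L -> strict_sub (phi K) (phi L)) ->
  has_chain_between I J k -> has_chain_between I' J' k.
Proof.
move=> phi_between phi_strict [C [Cbetween Cstrict]].
exists (phi \o C); split=> i ik; first exact/phi_between/Cbetween.
by apply: phi_strict; [apply/Cbetween/ltnW | apply: Cbetween | apply: Cstrict].
Qed.

Lemma has_chain_colon B x k :
  has_chain_between B (adjoin B x) k -> has_chain_between (colon B x) (@unit_ideal R) k.
Proof.
apply: (@has_chain_map (fun K => colon K x)).
  by move=> K [idK [BK _]]; split=> //; split=> // c; apply: BK.
move=> K L [idK [BK _]] [idL [_ LBx]] [KL nLK]; split=> [c|colonLK]; first exact: KL.
apply: nLK; apply: (@modular_sub_ideal _ K L (ideal_scale (@unit_ideal R) x)) => //.
  by apply: sub_ideal_trans LBx _; apply: ideal_add_mono.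
by move=> y [Ly [c _ yE]]; rewrite yE in Ly *; apply: colonLK.
Qed.

Lemma has_chain_adjoin B x k : is_ideal B ->
  has_chain_between (colon B x) (@unit_ideal R) k -> has_chain_between B (adjoin B x) k.
Proof.
move=> idB; apply: (@has_chain_map (fun K => ideal_add B (ideal_scale K x))).
  move=> K [idK _]; split=> //; split; first exact: ideal_add_subl.
  by apply: ideal_add_mono => // _ [c _ ->]; exists c.
move=> K L [idK [BxK _]] [idL _] [KL nLK]; split.
  by apply: ideal_add_mono => // _ [c /KL Lc ->]; exists c.
move=> BLx_BKx; apply: nLK => c Lc.
have [|b [_ [Bb [d Kd ->] cxE]]] := BLx_BKx (c * x); first by apply: ideal_add_subr => //; exists c.
rewrite -(subrK d c); apply: idealD => //; apply: BxK.
by rewrite /colon mulrBl cxE addrK.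
Qed.

Lemma length_eq_adjoin B x l : is_ideal B ->
  length_eq (colon B x) (@unit_ideal R) l -> length_eq B (adjoin B x) l.
Proof.
move=> idB [Bxl lenBx]; split; first exact: has_chain_adjoin.
by move=> /has_chain_colon.
Qed.

Lemma colength_le_setI I J M k : is_ideal M -> sub_ideal (J `&` M)%classic I ->
  colength_le M k -> length_le I J k.
Proof.
move=> idM JMI lenM IJk; apply: lenM; move: IJk.
apply: (@has_chain_map (fun K => ideal_add K M)) => [K [idK _]|].
  by split=> //; split=> //; apply: ideal_add_subr.
move=> K L [idK [IK _]] [idL [_ LJ]] [KL nLK]; split=> [|LMKM]; first exact: ideal_add_mono.
apply: nLK; apply: (@modular_sub_ideal _ K L M) => //.
  exact: sub_ideal_trans (ideal_add_subl idM) LMKM.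
by move=> x [/LJ Jx Mx]; apply/IK/JMI.
Qed.

End Length.

(** * Noetherian rings *)

Section Noetherian.
Variable R : comNzRingType.
Hypothesis noethR : noetherian R.
Implicit Types (A B I J K P Q : R -> Prop) (Ps : seq (R -> Prop)) (x y : R).

Lemma noetherian_ind (T : (R -> Prop) -> Prop) :
  (forall I, is_ideal I -> (forall J, is_ideal J -> strict_sub I J -> T J) -> T I) ->
  forall I, is_ideal I -> T I.
Proof.
move=> step I idI; apply: contrapT => nTI.
pose bad := {K | is_ideal K /\ ~ T K}.
have next (K : bad) : {L : bad | strict_sub (sval K) (sval L)}.
  apply: cid; case: K => K [idK nTK] /=; apply: contrapT => noL; apply/nTK/step => // L idL KL.
  by apply: contrapT => nTL; apply: noL; exists (exist _ L (conj idL nTL)).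
have [C [_ Cstrict]] := dependent_choice next (exist _ I (conj idI nTI)).
have [N stableN] : exists N, forall n, (N <= n)%N -> sub_ideal (sval (C n)) (sval (C N)).
  by apply: noethR => n; [case: (svalP (C n)) | case: (Cstrict n)].
by case: (Cstrict N) => _; apply; apply: stableN.
Qed.

Lemma ideal_fg I : is_ideal I -> exists s : seq R, I = seq_ideal s.
Proof.
move=> idI; suff fg_above K : is_ideal K -> sub_ideal K I ->
    (exists s, K = seq_ideal s) -> exists s, I = seq_ideal s.
  apply: (fg_above (seq_ideal [::])) => //; last by exists [::].
  exact: span_min.
move: K; apply: noetherian_ind => K idK IH KI [s Ks].
have [IK|/not_sub_ideal[x Ix nKx]] := EM (sub_ideal I K).
  by exists s; rewrite -Ks; apply/seteqP.
apply: (IH (adjoin K x)); [by [] | exact: strict_sub_adjoin | exact: adjoin_min |].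
by exists (x :: s); rewrite seq_ideal_cons Ks.
Qed.

Definition ideal_prods Ps := foldr (@ideal_mul R) (@unit_ideal R) Ps.

Definition all_primes_over I Ps := forall P, List.In P Ps -> prime_ideal P /\ sub_ideal I P.

Lemma ideal_prods_is_ideal Ps : (forall P, List.In P Ps -> is_ideal P) -> is_ideal (ideal_prods Ps).
Proof. by case: Ps => //= P Ps idPs; apply: mul_is_ideal; apply: idPs; left. Qed.

Lemma ideal_prods_cat Ps Qs : (forall P, List.In P (Ps ++ Qs) -> is_ideal P) ->
  ideal_prods (Ps ++ Qs) = ideal_mul (ideal_prods Ps) (ideal_prods Qs).
Proof.
elim: Ps => /= [|P Ps IH] idPQ; first by rewrite ideal_mul1 //; apply: ideal_prods_is_ideal.
have idcat Q : List.In Q (Ps ++ Qs) -> is_ideal Q by move=> PsQs; apply: idPQ; right.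
rewrite IH // ideal_mulA //; first by apply: idPQ; left.
all: by apply: ideal_prods_is_ideal => Q inQ; apply/idcat/List.in_app_iff; auto.
Qed.

Lemma ideal_prods_sub Ps P : (forall Q, List.In Q Ps -> is_ideal Q) -> List.In P Ps ->
  sub_ideal (ideal_prods Ps) P.
Proof.
elim: Ps => //= Q Ps IH idPs [<-|inP]; first by apply: ideal_mul_subl; apply: idPs; left.
apply: sub_ideal_trans (IH _ inP); last by move=> Q' inQ'; apply: idPs; right.
by apply: ideal_mul_subr; apply: ideal_prods_is_ideal => Q' inQ'; apply: idPs; right.
Qed.

Lemma prime_ideal_mul A B P : prime_ideal P -> sub_ideal (ideal_mul A B) P ->
  sub_ideal A P \/ sub_ideal B P.
Proof.
move=> [_ [_ primeP]] ABP.
have [|/not_sub_ideal[a Aa nPa]] := EM (sub_ideal A P); first by left.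
by right=> b Bb; case: (primeP a b) => //; apply/ABP/mem_ideal_mul.
Qed.

Lemma prime_ideal_prods Ps P : prime_ideal P -> sub_ideal (ideal_prods Ps) P ->
  exists2 Q, List.In Q Ps & sub_ideal Q P.
Proof.
move=> primeP; elim: Ps => [|Q Ps IH] /=; first by case: primeP => [_ [nP1 _]] /(_ 1 I)/nP1.
case/(prime_ideal_mul primeP) => [QP|/IH[Q' inQ' Q'P]]; first by exists Q; first left.
by exists Q'; first right.
Qed.

Lemma not_prime_ideal I : is_ideal I -> ~ I 1 -> ~ prime_ideal I ->
  exists x y, [/\ I (x * y), ~ I x & ~ I y].
Proof.
move=> idI nI1 nprimeI; apply: contrapT => noxy; apply: nprimeI; split=> //; split=> // x y Ixy.
have [|nIx] := EM (I x); first by left.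
by right; apply: contrapT => nIy; apply: noxy; exists x, y.
Qed.

Lemma exists_prime_product_sub I : is_ideal I ->
  exists2 Ps, all_primes_over I Ps & sub_ideal (ideal_prods Ps) I.
Proof.
move: I; apply: noetherian_ind => I idI IH.
have [I1|nI1] := EM (I 1); first by exists [::]; rewrite ?(eq_unit_ideal idI I1).
have [primeI|] := EM (prime_ideal I).
  exists [:: I]; last exact: ideal_mul_subl.
  by move=> P /= [<-|//]; split=> //; apply: sub_ideal_refl.
move=> /(not_prime_ideal idI nI1)[x [y [Ixy nIx nIy]]].
have [Ps overPs PsI] := IH _ (adjoin_is_ideal x idI) (strict_sub_adjoin idI nIx).
have [Qs overQs QsI] := IH _ (adjoin_is_ideal y idI) (strict_sub_adjoin idI nIy).
have overI : all_primes_over I (Ps ++ Qs).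
  by move=> P /List.in_app_iff[/overPs|/overQs][primeP IaP]; split=> //;
    apply: sub_ideal_trans IaP; apply: sub_adjoin.
exists (Ps ++ Qs) => //; rewrite ideal_prods_cat; last by move=> P /overI[[]].
apply: ideal_mul_min => // a b /PsI[u [_ [Iu [c _ ->] ->]]] /QsI[v [_ [Iv [d _ ->] ->]]].
have -> : (u + c * x) * (v + d * y) = (v + d * y) * u + (c * x) * v + (c * d) * (x * y).
  by ring.
by do 2?[apply: idealD => //]; apply: idealMl.
Qed.

(* Avoiding [P] also avoids the primes contained in [P]; the product of [A] with the remaining
   primes is not contained in [P]. *)
Lemma prime_avoidance A Ps : is_ideal A ->
  (forall P, List.In P Ps -> prime_ideal P /\ ~ sub_ideal A P) ->
  exists2 x, A x & forall P, List.In P Ps -> ~ P x.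
Proof.
move=> idA; have [n] := ubnP (size Ps); elim: n Ps => // n IH [|P Ps] /=.
  by move=> _ _; exists 0; first exact: ideal0.
rewrite ltnS => sizePs avoid; have [primeP nAP] := avoid P (or_introl erefl).
have [idP [_ mulP]] := primeP.
pose Qs := [seq Q <- Ps | ~~ `[< sub_ideal Q P >]].
have inQs Q : List.In Q Qs <-> List.In Q Ps /\ ~ sub_ideal Q P.
  split=> [/List.filter_In[inQ /asboolPn]|[inQ nQP]] //.
  by apply/List.filter_In; split=> //; apply/asboolPn.
have avoidQs Q : List.In Q Qs -> prime_ideal Q /\ ~ sub_ideal A Q.
  by move=> /inQs[inQ _]; apply: avoid; right.
have idQs Q : List.In Q Qs -> is_ideal Q by move=> /avoidQs[[]].
have avoid_all x : ~ P x -> (forall Q, List.In Q Qs -> ~ Q x) ->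
    forall Q, P = Q \/ List.In Q Ps -> ~ Q x.
  move=> nPx nQx Q [<-//|inQ] Qx; have [QP|nQP] := EM (sub_ideal Q P); first exact/nPx/QP.
  by apply: (nQx Q) => //; apply/inQs.
have [|x Ax nQx] := IH Qs _ avoidQs.
  by rewrite (leq_ltn_trans _ sizePs) // size_filter count_size.
have [Px|nPx] := EM (P x); last by exists x => //; apply: avoid_all.
have [z AQz nPz] : exists2 z, ideal_mul A (ideal_prods Qs) z & ~ P z.
  apply: not_sub_ideal => /(prime_ideal_mul primeP)[//|/(prime_ideal_prods primeP)].
  by case=> Q /inQs[].
have Az : A z := ideal_mul_subl idA AQz.
have Qz Q : List.In Q Qs -> Q z.
  by move=> inQ; apply/(ideal_prods_sub idQs inQ)/(ideal_mul_subr (ideal_prods_is_ideal idQs) AQz).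
exists (x + z); first exact: idealD.
apply: avoid_all => [Pxz|Q inQ Qxz]; first by apply: nPz; rewrite -(addKr x z) addrC; apply: idealB.
apply: (nQx Q inQ); rewrite -(addrK z x); apply: idealB => //; exact: Qz.
Qed.

End Noetherian.

Section Colength.
Variable R : comNzRingType.
Implicit Types (A I J : R -> Prop) (a b x y : R) (s : seq R) (k l n : nat).

Lemma colength_le_mono I J k : sub_ideal I J -> colength_le I k -> colength_le J k.
Proof. by move=> IJ; apply: length_le_mono. Qed.

Lemma colength_le_adjoin_mul A a b k l : is_ideal A ->
  colength_le (adjoin A a) k -> colength_le (adjoin A b) l ->
  colength_le (adjoin A (a * b)) (k + l).
Proof.
move=> idA lenAa lenAb; rewrite addnC.
apply: (@length_leD _ _ (adjoin (adjoin A (a * b)) a)) => //.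
- exact: sub_adjoin.
- move=> chain; apply: lenAb; apply: has_chain_mono (has_chain_colon chain) => //.
  apply: adjoin_min => //; first by move=> x Ax; apply: sub_adjoin; apply: idealMr.
  by rewrite /colon mulrC; apply: mem_adjoin.
- apply: colength_le_mono lenAa; apply: adjoin_min => //; last exact: mem_adjoin.
  by apply: sub_ideal_trans (@sub_adjoin _ _ _); apply: sub_adjoin.
Qed.

Lemma colength_le_adjoin_exp A a k n : is_ideal A ->
  colength_le (adjoin A a) k -> colength_le (adjoin A (a ^+ n)) (n * k).
Proof.
move=> idA lenAa; elim: n => [|n IH]; last by rewrite exprS mulSn; apply: colength_le_adjoin_mul.
rewrite /colength_le -(@eq_unit_ideal _ (adjoin A (a ^+ 0))) //; first exact: length_le_refl.
exact: mem_adjoin.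
Qed.

Lemma add_seq_ideal_cons A x s :
  ideal_add A (seq_ideal (x :: s)) = ideal_add (adjoin A x) (seq_ideal s).
Proof. by rewrite seq_ideal_cons /adjoin ideal_addA ideal_addAC. Qed.

Lemma colength_le_seq_exp A s k n : is_ideal A ->
  colength_le (ideal_add A (seq_ideal s)) k ->
  colength_le (ideal_add A (seq_ideal [seq x ^+ n | x <- s])) (n ^ size s * k).
Proof.
elim: s A => [|x s IH] A idA; first by rewrite mul1n.
rewrite /= !add_seq_ideal_cons expnS -mulnA => /IH lenAxs.
rewrite /adjoin ideal_addAC; apply: colength_le_adjoin_exp => //.
by rewrite /adjoin ideal_addAC; apply: lenAxs.
Qed.

Lemma seq_ideal_exp_sub A s n : is_ideal A -> sub_ideal (seq_ideal s) A ->
  sub_ideal (seq_ideal [seq x ^+ n | x <- s]) (ideal_exp A n).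
Proof.
move=> idA sA; apply: span_min => // _ /mapP[x xs ->].
by apply: mem_ideal_exp; apply: sA; apply: mem_span.
Qed.

Lemma colength_le_exp_of_seq A s k n : is_ideal A -> sub_ideal (seq_ideal s) A ->
  colength_le (seq_ideal s) k -> colength_le (ideal_exp A n) (n ^ size s * k).
Proof.
move=> idA sA lens.
have : colength_le (ideal_add (seq_ideal [::]) (seq_ideal s)) k.
  by apply: colength_le_mono lens; apply: ideal_add_subr.
move=> /(colength_le_seq_exp (n := n) (seq_is_ideal [::])); apply: colength_le_mono.
apply: ideal_add_min => //; last exact: seq_ideal_exp_sub.
exact: span_min.
Qed.

End Colength.

(** * Noetherian local rings *)

Section LocalRing.
Variables (R : comNzRingType) (m : R -> Prop).
Hypothesis noethR : noetherian R.
Hypothesis maxm : maximal_ideal m.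
Hypothesis uniqm : forall M, maximal_ideal M -> forall x, M x <-> m x.
Implicit Types (A I J P Q : R -> Prop) (a x : R) (s : seq R) (k l n : nat).

Lemma maximal_is_ideal : is_ideal m. Proof. by case: maxm. Qed.

#[local] Hint Resolve maximal_is_ideal : ideals.

Lemma maximal_prime : prime_ideal m.
Proof.
have [_ [nm1 m_max]] := maxm; split=> //; split=> // x y mxy.
have [|nmx] := EM (m x); [by left | right].
have [//||[u [_ [mu [c _ ->] oneE]]]|mxm] := m_max (adjoin m x).
- exact: sub_adjoin.
- have -> : y = u * y + c * (x * y) by rewrite mulrA -mulrDl -oneE mul1r.
  by apply: idealD => //; [apply: idealMr | apply: idealMl].
- by case: nmx; apply: mxm; apply: mem_adjoin.
Qed.

Lemma colength_le_maximal : colength_le m 1.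
Proof.
have [_ [_ m_max]] := maxm.
move=> /has_chain_belast[K [L [[idK [mK _]] _ mK1 [_ nLK]]]].
have [K1|Km] := m_max K idK mK; first by apply: nLK; rewrite (eq_unit_ideal idK K1).
exact: length_le_refl (has_chain_mono _ Km mK1).
Qed.

Lemma proper_sub_maximal I : is_ideal I -> ~ I 1 -> sub_ideal I m.
Proof.
move: I; apply: (noetherian_ind noethR) => I idI IH nI1.
have [maxI x /(uniqm maxI)//|nmaxI] := EM (maximal_ideal I).
suff [J [idJ IJ nJ1]] : exists J, [/\ is_ideal J, strict_sub I J & ~ J 1].
  by case: (IJ) => sIJ _; apply: sub_ideal_trans sIJ (IH J idJ IJ nJ1).
apply: contrapT => noJ; apply: nmaxI; do 2!split=> //; move=> J idJ IJ.
have [|nJ1] := EM (J 1); first by left.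
by right; apply: contrapT => nJI; apply: noJ; exists J.
Qed.

Lemma maximal_one_sub_unit a : m a -> exists u, u * (1 - a) = 1.
Proof.
move=> ma; apply: contrapT => nonunit; have [_ [nm1 _]] := maxm.
have : sub_ideal (ideal_scale (@unit_ideal R) (1 - a)) m.
  by apply: proper_sub_maximal => // -[u _ uE]; apply: nonunit; exists u.
move=> /(_ (1 - a)) m1a; apply: nm1; rewrite -(subrK a 1); apply: idealD => //.
by apply: m1a; exists 1; rewrite ?mul1r.
Qed.

Lemma mem_adjoin_maximal_mul I a x : is_ideal I -> m a -> adjoin I (a * x) x -> I x.
Proof.
move=> idI ma [b [_ [Ib [c _ ->] xE]]].
have [u uE] := maximal_one_sub_unit (idealMl c maximal_is_ideal ma).
rewrite -[x]mul1r -uE -mulrA; apply: idealMl => //.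
by have -> : (1 - c * a) * x = b by rewrite mulrBl mul1r -mulrA {1}xE addrK.
Qed.

Lemma maximal_exp_sub_colon I x l : is_ideal I ->
  length_le I (adjoin I x) l -> sub_ideal (ideal_exp m l) (colon I x).
Proof.
move=> idI; elim: l x => [|l IH] x lenIx.
  move=> c _; apply: idealMl => //; apply: (length_le0 _ _ _ lenIx) => //.
    exact: sub_adjoin.
  exact: mem_adjoin.
rewrite ideal_expS ideal_mulC; apply: ideal_mul_min => // c b mc mb.
rewrite /colon -mulrA; have [Ix|nIx] := EM (I x); first by do 2!apply: idealMl => //.
apply: IH mc => Ibx; apply: lenIx; apply: has_chain_rcons Ibx (adjoin_is_ideal x idI) _ _ => //.
split=> [|IxIbx]; last by apply/nIx/(mem_adjoin_maximal_mul idI mb)/IxIbx; apply: mem_adjoin.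
apply: adjoin_min => //; first exact: sub_adjoin.
by apply: idealMl => //; apply: mem_adjoin.
Qed.

Lemma maximal_exp_mul_sub I J l : is_ideal I -> is_ideal J -> sub_ideal I J ->
  length_le I J l -> sub_ideal (ideal_mul (ideal_exp m l) J) I.
Proof.
move=> idI idJ IJ lenIJ; apply: ideal_mul_min => // a x ma Jx.
apply: maximal_exp_sub_colon ma => //; apply: length_le_mono lenIJ => //.
exact: adjoin_min.
Qed.

Lemma colength_le_maximal_exp n : exists k, colength_le (ideal_exp m n) k.
Proof.
have [s mE] := ideal_fg noethR maximal_is_ideal; exists (n ^ size s * 1)%N.
by apply: colength_le_exp_of_seq; rewrite -?mE //; apply: colength_le_maximal.
Qed.

Definition height_ge k P := exists C : nat -> R -> Prop,
  [/\ forall i, (i <= k)%N -> prime_ideal (C i),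
      forall i, (i < k)%N -> strict_sub (C i) (C i.+1) & C k = P].

Lemma height_geS k P Q : height_ge k P -> prime_ideal Q -> strict_sub P Q ->
  height_ge k.+1 Q.
Proof.
move=> [C [Cprime Cstrict CkP]] primeQ PQ.
exists (fun i => if (i <= k)%N then C i else Q); split; last by rewrite ltnn.
  by move=> i _; case: ifP => // /Cprime.
move=> i ik1; have [ik|ki] := ltnP i k; first by rewrite (ltnW ik); apply: Cstrict.
have -> : i = k by apply/eqP; rewrite eqn_leq ki andbT.
by rewrite leqnn CkP.
Qed.

Lemma strict_sub_maximal P : prime_ideal P -> P <> m -> strict_sub P m.
Proof.
move=> [idP [nP1 _]] nPm; have Pm := proper_sub_maximal idP nP1.
by split=> // mP; apply: nPm; apply/seteqP.
Qed.

Definition primes_over_height_ge d I := forall P,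
  prime_ideal P -> sub_ideal I P -> P = m \/ height_ge d P.

(* Every prime over [(s)] contains one of finitely many primes over [(s)] with product inside [(s)].
   If [x] avoids those different from [m], a prime over [(s, x)] other than [m] contains one of them
   strictly. *)
Lemma primes_over_height_ge_cons d s : primes_over_height_ge d (seq_ideal s) -> exists2 x, m x &
  primes_over_height_ge d.+1 (seq_ideal (x :: s)).
Proof.
move=> high; have [Ps overPs Ps_s] := exists_prime_product_sub noethR (seq_is_ideal s).
pose Qs := [seq P <- Ps | ~~ `[< P = m >]].
have [|x mx nQx] := @prime_avoidance _ m Qs maximal_is_ideal.
  move=> P /List.filter_In[/overPs[primeP _] /asboolPn nPm]; split=> //.
  by have [_] := strict_sub_maximal primeP nPm.
exists x => // P primeP; rewrite seq_ideal_cons => xsP.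
have [|Q inQ QP] := @prime_ideal_prods _ Ps P primeP.
  by apply: sub_ideal_trans Ps_s (sub_ideal_trans _ xsP); apply: sub_adjoin.
have [->|nPm] := EM (P = m); [by left | right].
have [primeQ sQ] := overPs Q inQ.
have nQm : Q <> m.
  by move=> Qm; have [_] := strict_sub_maximal primeP nPm; apply; rewrite -Qm.
have [//|highQ] := high Q primeQ sQ; apply: height_geS highQ primeP _; split=> // PQ.
apply: (nQx Q); first by apply/List.filter_In; split=> //; apply/asboolPn.
by apply/PQ/xsP; apply: mem_adjoin.
Qed.

Lemma exists_primes_over_height_ge d : exists s,
  [/\ size s = d, sub_ideal (seq_ideal s) m & primes_over_height_ge d (seq_ideal s)].
Proof.
elim: d => [|d [s [sized sm high]]].
  exists [::]; split=> //; first exact: span_min.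
  by move=> P primeP _; right; exists (fun=> P).
have [x mx high'] := primes_over_height_ge_cons high.
exists (x :: s); split=> //; first by rewrite /= sized.
by rewrite seq_ideal_cons; apply: adjoin_min.
Qed.

Lemma maximal_exp_sub I : is_ideal I ->
  (forall P, prime_ideal P -> sub_ideal I P -> P = m) ->
  exists e, sub_ideal (ideal_exp m e) I.
Proof.
move=> idI onlym; have [Ps overPs PsI] := exists_prime_product_sub noethR idI.
exists (size Ps); apply: sub_ideal_trans PsI.
elim: Ps overPs => //= P Ps IH overPs.
have [primeP IP] := overPs P (or_introl erefl).
rewrite (onlym P primeP IP); apply: ideal_mul_mono => //; apply: IH => Q inQ.
by apply: overPs; right.
Qed.

Lemma exists_parameters d : ~ has_prime_chain R d.+1 -> exists s,
  [/\ size s = d, sub_ideal (seq_ideal s) m &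
      exists e, sub_ideal (ideal_exp m e) (seq_ideal s)].
Proof.
move=> nochain; have [s [sized sm high]] := exists_primes_over_height_ge d.
exists s; split=> //; apply: maximal_exp_sub => // P primeP sP.
have [//|highP] := high P primeP sP; apply: contrapT => nPm; apply: nochain.
have [C [Cprime Cstrict _]] := height_geS highP maximal_prime (strict_sub_maximal primeP nPm).
by exists C.
Qed.

(* For parameters [x_1, .., x_d],
   [l(R/m^n) <= l(R/(x_1^n, .., x_d^n)) <= n^d l(R/(x_1, .., x_d))]. *)
Lemma colength_maximal_exp_growth d : ~ has_prime_chain R d.+1 ->
  exists k, forall n, colength_le (ideal_exp m n) (n ^ d * k).
Proof.
move=> /exists_parameters[s [<- sm [e es]]]; have [k lenme] := colength_le_maximal_exp e.
by exists k => n; apply: colength_le_exp_of_seq => //; apply: colength_le_mono lenme.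
Qed.

End LocalRing.

(** * Exponent vectors *)

Section Exponents.
Implicit Types (g c : nat).

Lemma nondecreasing_subsequence (u : nat -> nat) : exists phi : nat -> nat,
  {homo phi : i j / (i < j)%N} /\ {homo u \o phi : i j / (i <= j)%N}.
Proof.
have tail_min n : exists p, (n < p)%N /\ forall q, (p <= q)%N -> (u p <= u q)%N.
  suff below b p : (n < p)%N -> (u p < b)%N ->
      exists p, (n < p)%N /\ forall q, (p <= q)%N -> (u p <= u q)%N.
    exact: (below (u n.+1).+1 n.+1).
  elim: b p => // b IH p np upb.
  have [min_p|/existsNP[q /not_implyP[pq /negP]]] := EM (forall q, (p <= q)%N -> (u p <= u q)%N).
    by exists p.
  by rewrite -ltnNge => uqp; apply: (IH q); [apply: leq_trans np pq | apply: leq_trans uqp upb].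
have [f fP] := choice tail_min; pose phi i := iter i f (f 0%N).
have phi_lt : {homo phi : i j / (i < j)%N}.
  by apply: homo_ltn => [x y z|i]; [apply: ltn_trans | case: (fP (phi i))].
have phi_min i q : (phi i <= q)%N -> (u (phi i) <= u q)%N.
  by case: i => [|i]; apply: (proj2 (fP _)).
by exists phi; split=> // i j ij; apply: phi_min; apply: ltnW_homo phi_lt _ _ ij.
Qed.

Lemma dickson g (u : nat -> 'X_{1..g}) : exists phi : nat -> nat,
  {homo phi : i j / (i < j)%N} /\ {homo u \o phi : i j / (i <= j)%N >-> (i <= j)%MM}.
Proof.
suff [phi [phi_lt phi_le]] : exists phi : nat -> nat, {homo phi : i j / (i < j)%N} /\
    forall l, l \in enum 'I_g -> {homo (fun k => u (phi k) l) : i j / (i <= j)%N}.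
  exists phi; split=> // i j ij; apply/mnm_lepP => l.
  by apply: phi_le; rewrite ?mem_enum.
elim: (enum 'I_g) => [|l s [phi [phi_lt phi_le]]]; first by exists id; split.
have [psi [psi_lt psi_le]] := nondecreasing_subsequence (fun k => u (phi k) l).
exists (phi \o psi); split=> [i j ij|l']; first exact/phi_lt/psi_lt.
rewrite inE => /predU1P[->|sl'] i j ij; first exact: psi_le.
by apply: (phi_le l' sl'); apply: ltnW_homo psi_lt _ _ ij.
Qed.

Definition mtrunc g c (mu : 'X_{1..g}) : 'X_{1..g} := [multinom minn (mu i) c | i < g].

Lemma mtrunc_le g c (mu : 'X_{1..g}) : (mtrunc c mu <= mu)%MM.
Proof. by apply/mnm_lepP => i; rewrite mnmE geq_minl. Qed.

Lemma mtruncK g c (mu : 'X_{1..g}) : mtrunc c (mtrunc c mu) = mtrunc c mu.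
Proof. by apply/mnmP => i; rewrite !mnmE -minnA minnn. Qed.

Lemma leq_mdeg g (mu : 'X_{1..g}) i : (mu i <= mdeg mu)%N.
Proof. by rewrite mdegE (bigD1 i) //= leq_addr. Qed.

Lemma le_mtrunc g c (mu nu : 'X_{1..g}) : (mu <= nu)%MM -> (mdeg mu <= c)%N ->
  (mu <= mtrunc c nu)%MM.
Proof.
move=> /mnm_lepP munu muc; apply/mnm_lepP => i; rewrite mnmE leq_min munu.
exact: leq_trans (leq_mdeg mu i) muc.
Qed.

(* If no [c] works, counterexamples [mu_c] have a subsequence that increases coordinatewise and
   along which [L] is eventually constant; an early term lies below the truncations of the later
   ones. *)
Lemma monotone_ideals_stable (R : comNzRingType) g (L : 'X_{1..g} -> R -> Prop) :
  noetherian R -> (forall mu, is_ideal (L mu)) ->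
  (forall mu nu, (mu <= nu)%MM -> sub_ideal (L mu) (L nu)) ->
  exists c, forall c' mu, (c <= c')%N -> sub_ideal (L mu) (L (mtrunc c' mu)).
Proof.
move=> noethR idL monoL; apply: contrapT => unstable.
have bad c : exists cmu : nat * 'X_{1..g},
    (c <= cmu.1)%N /\ ~ sub_ideal (L cmu.2) (L (mtrunc cmu.1 cmu.2)).
  apply: contrapT => nobad; apply: unstable; exists c => c' mu cc'.
  by apply: contrapT => nsub; apply: nobad; exists (c', mu).
have [f fP] := choice bad; have [phi [phi_lt phi_le]] := dickson (snd \o f).
have [N stableN] : exists N, forall n, (N <= n)%N ->
    sub_ideal (L (f (phi n)).2) (L (f (phi N)).2).
  by apply: noethR => n //; apply/monoL/phi_le.
pose k := maxn N (mdeg (f (phi N)).2).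
have [phik_c] := fP (phi k); apply.
apply: sub_ideal_trans (stableN k (leq_maxl _ _)) (monoL _ _ _).
apply: le_mtrunc; first exact/phi_le/leq_maxl.
have k_phi : (k <= phi k)%N by elim: (k) => // n IH; apply: leq_ltn_trans IH (phi_lt _ _ _).
exact: leq_trans (leq_maxr _ _) (leq_trans k_phi phik_c).
Qed.

End Exponents.

Section Multidegree.
Variables (g r : nat) (deg : 'I_g -> 'I_r).
Implicit Types (mu nu : 'X_{1..g}) (n : 'X_{1..r}) (S : pred 'I_g).

Definition multideg mu : 'X_{1..r} := [multinom (\sum_(j | deg j == i) mu j)%N | i < r].

Lemma multideg0 : multideg 0%MM = 0%MM.
Proof. by apply/mnmP => i; rewrite !mnmE big1 // => j _; rewrite mnmE. Qed.

Lemma multidegD mu nu : multideg (mu + nu)%MM = (multideg mu + multideg nu)%MM.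
Proof. by apply/mnmP => i; rewrite !mnmE -big_split; apply: eq_bigr => j _; rewrite mnmE. Qed.

Lemma multidegU j : multideg U_(j)%MM = U_(deg j)%MM.
Proof.
apply/mnmP => i; rewrite !mnmE; have [degj|degj] := eqVneq (deg j) i.
  rewrite (bigD1 j) ?degj //= mnm1E eqxx big1 // => k /andP[_].
  by rewrite mnm1E eq_sym => /negPf->.
by rewrite big1 // => k /eqP degk; rewrite mnm1E; case: (j =P k) degj => // ->; rewrite degk eqxx.
Qed.

Lemma mdeg_multideg mu : mdeg (multideg mu) = mdeg mu.
Proof.
rewrite !mdegE (partition_big deg xpredT) //=.
by apply: eq_bigr => i _; rewrite mnmE.
Qed.

Lemma multideg_neq0 mu i : multideg mu i != 0%N -> exists2 j, deg j = i & mu j != 0%N.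
Proof.
rewrite mnmE sum_nat_eq0 negb_forall_in => /existsP[j /andP[/eqP degj muj]].
by exists j.
Qed.

Lemma leq_multideg mu c i : (forall j, (mu j <= c)%N) -> (multideg mu i <= g * c)%N.
Proof.
move=> mu_le; apply: leq_trans (leq_mdeg _ _) _; rewrite mdeg_multideg mdegE.
by apply: leq_trans (leq_sum _ (fun j _ => mu_le j)) _; rewrite sum_nat_const card_ord.
Qed.

Definition supported S mu := [forall j, (mu j != 0%N) ==> S j].

Lemma supportedP S mu : reflect (forall j, mu j != 0%N -> S j) (supported S mu).
Proof. by apply: (iffP forallP) => supp j; apply/implyP; apply: supp. Qed.

Lemma supportedD S mu nu : supported S mu -> supported S nu -> supported S (mu + nu)%MM.
Proof.
move=> /supportedP muS /supportedP nuS; apply/supportedP => j.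
by rewrite mnmDE addn_eq0 negb_and => /orP[/muS|/nuS].
Qed.

Lemma supportedU S j : supported S U_(j)%MM = S j.
Proof.
apply/supportedP/idP => [|Sj k]; first by apply; rewrite mnm1E eqxx.
by rewrite mnm1E; case: (j =P k) => // <-.
Qed.

Lemma lt_supported S mu nu : (forall j l, ~~ S j -> S l -> (j < l)%N) -> mdeg mu = mdeg nu ->
  supported S mu -> ~~ supported S nu -> (mu < nu)%O.
Proof.
move=> S_up mdegE /supportedP muS; rewrite negb_forall => /existsP[j0].
rewrite negb_imply => j0P; pose P j := (nu j != 0%N) && ~~ S j.
case: (@arg_minnP _ j0 P (fun j => val j) j0P) => j /andP[nuj nSj] j_min.
have mu0 l : ~~ S l -> mu l = 0%N by move=> nSl; apply: contraNeq nSl => /muS.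
apply/ltmcP => //; exists j => [l lj|]; last by rewrite mu0 // lt0n.
have nSl : ~~ S l by apply: contraL lj => Sl; rewrite -leqNgt ltnW ?S_up.
rewrite mu0 //; apply/esym/eqP; apply: contraLR lj => nul.
by rewrite -leqNgt j_min // /P nul.
Qed.

End Multidegree.

Lemma mmap1_add g (R : comNzRingType) (y : 'I_g -> R) (mu nu : 'X_{1..g}) :
  mmap1 y (mu + nu) = mmap1 y mu * mmap1 y nu.
Proof. by apply: commr_mmap1_M => i x; apply: mulrC. Qed.

(** * Ideals spanned by monomials *)

Section MonomialSpans.
Variables (R : comNzRingType) (g r : nat) (deg : 'I_g -> 'I_r) (y : 'I_g -> R).
Implicit Types (mu nu gam : 'X_{1..g}) (n : 'X_{1..r}) (S : pred 'I_g) (Q : 'X_{1..g} -> Prop).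
Local Notation mdegr := (multideg deg).

Definition mon_span Q : R -> Prop := ideal_span (fun x => exists2 mu, Q mu & x = mmap1 y mu).

Definition var_span S i : R -> Prop :=
  ideal_span (fun x => exists j, [/\ S j, deg j = i & x = y j]).

Definition hom_span S n := mon_span (fun mu => supported S mu /\ mdegr mu = n).

Definition lower_span mu := mon_span (fun nu => (nu < mu)%O /\ mdegr nu = mdegr mu).

Lemma mon_span_is_ideal Q : is_ideal (mon_span Q). Proof. exact: span_is_ideal. Qed.

Lemma var_span_is_ideal S i : is_ideal (var_span S i). Proof. exact: span_is_ideal. Qed.

Lemma hom_span_is_ideal S n : is_ideal (hom_span S n). Proof. exact: span_is_ideal. Qed.

Lemma lower_span_is_ideal mu : is_ideal (lower_span mu). Proof. exact: span_is_ideal. Qed.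

#[local] Hint Resolve mon_span_is_ideal var_span_is_ideal hom_span_is_ideal
  lower_span_is_ideal : ideals.

Lemma mem_mon_span Q mu : Q mu -> mon_span Q (mmap1 y mu).
Proof. by move=> Qmu; apply: mem_span; exists mu. Qed.

Lemma mon_span_min Q K : is_ideal K -> (forall mu, Q mu -> K (mmap1 y mu)) ->
  sub_ideal (mon_span Q) K.
Proof. by move=> idK QK; apply: span_min => // _ [mu Qmu ->]; apply: QK. Qed.

Lemma eq_mon_span Q Q' : (forall mu, Q mu <-> Q' mu) -> mon_span Q = mon_span Q'.
Proof. by move=> /predeqP->. Qed.

Lemma mon_span_adjoin Q mu :
  mon_span (fun nu => Q nu \/ nu = mu) = adjoin (mon_span Q) (mmap1 y mu).
Proof.
apply/seteqP; split.
  apply: mon_span_min => // nu [Qnu|->]; last exact: mem_adjoin.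
  by apply: sub_adjoin; apply: mem_mon_span.
apply: adjoin_min => //; last by apply: mem_mon_span; right.
by apply: mon_span_min => // nu Qnu; apply: mem_mon_span; left.
Qed.

Lemma mon_span_lead Q x : mon_span Q x ->
  x = 0 \/ exists mu d b, [/\ Q mu, mon_span (fun nu => Q nu /\ (nu < mu)%O) b
                            & x = d * mmap1 y mu + b].
Proof.
elim=> [|a _ z [nu Qnu ->] _ [->|[mu [d [b [Qmu lower_b ->]]]]]]; first by left.
  by right; exists nu, a, 0; split=> //; apply: ideal0.
right; have [numu|munu|->] := ltgtP nu mu.
- exists mu, d, (a * mmap1 y nu + b); rewrite addrCA; split=> //.
  by apply: idealD => //; apply: idealMl => //; apply: mem_mon_span.
- exists nu, a, (d * mmap1 y mu + b); split=> //; apply: idealD => //.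
    by apply: idealMl => //; apply: mem_mon_span.
  apply: mon_span_min lower_b => // xi [Qxi xi_mu]; apply: mem_mon_span.
  by split=> //; apply: lt_trans munu.
- by exists mu, (a + d), b; rewrite mulrDl addrA.
Qed.

Lemma hom_span_mul_var S i n :
  ideal_mul (var_span S i) (hom_span S n) = hom_span S (U_(i) + n)%MM.
Proof.
apply/seteqP; split.
  apply: span_mul_min => // _ _ [j [Sj degj ->]] [mu [muS mun] ->].
  rewrite -(mmap1U y j) -mmap1_add; apply: mem_mon_span.
  by rewrite multidegD multidegU degj mun supportedD ?supportedU.
apply: mon_span_min => // mu [muS mun].
have [|j degj muj] := @multideg_neq0 _ _ deg mu i; first by rewrite mun mnmDE mnm1E eqxx.
have muE : mu = (U_(j) + (mu - U_(j)))%MM by rewrite addmC submK ?lep1mP.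
rewrite muE mmap1_add mmap1U; apply: mem_ideal_mul.
  by apply: mem_span; exists j; split=> //; apply: (supportedP _ _ muS).
apply: mem_mon_span; split.
  apply/supportedP => k; rewrite mnmBE => muk; apply: (supportedP _ _ muS).
  by apply: contra muk => /eqP->; rewrite sub0n.
by apply: (@addmI _ U_(i)%MM); rewrite -mun [in RHS]muE multidegD multidegU degj.
Qed.

Lemma hom_span_mul_var_exp S i e n :
  ideal_mul (ideal_exp (var_span S i) e) (hom_span S n) = hom_span S (U_(i) *+ e + n)%MM.
Proof.
elim: e => [|e IH]; first by rewrite ideal_mul1 // add0m.
rewrite ideal_expS -ideal_mulA //.
by rewrite IH hom_span_mul_var mulmS addmA.
Qed.

Lemma hom_span0 S : hom_span S 0%MM = @unit_ideal R.
Proof.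
apply: eq_unit_ideal => //; rewrite -(mmap11 y); apply: mem_mon_span.
by rewrite multideg0; split=> //; apply/supportedP => j; rewrite mnm0E.
Qed.

Lemma ideal_prod_exp_hom_span S (A : 'I_r -> R -> Prop) n :
  (forall i, A i = var_span S i) -> ideal_prod_exp A n = hom_span S n.
Proof.
move=> AE; rewrite [n in RHS]multinomUE_id -big_enum /ideal_prod_exp.
elim: (enum 'I_r) => [|i s IH]; first by rewrite big_nil hom_span0.
by rewrite big_cons /= IH AE hom_span_mul_var_exp.
Qed.

Lemma mem_lower_span_mul gam mu b : lower_span mu b ->
  lower_span (gam + mu)%MM (mmap1 y gam * b).
Proof.
suff: sub_ideal (lower_span mu) (colon (lower_span (gam + mu)%MM) (mmap1 y gam)).
  by move=> sub_colon lower_b; rewrite mulrC; apply: sub_colon.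
apply: mon_span_min => // nu [nu_mu degnu].
rewrite /colon mulrC -mmap1_add; apply: mem_mon_span.
by rewrite ltmc_add2r !multidegD degnu.
Qed.

End MonomialSpans.

#[local] Hint Resolve mon_span_is_ideal var_span_is_ideal hom_span_is_ideal
  lower_span_is_ideal : ideals.

Lemma exists_generators (R : comNzRingType) r (I J : 'I_r -> R -> Prop) : noetherian R ->
  (forall i, is_ideal (I i)) -> (forall i, is_ideal (J i)) ->
  (forall i, sub_ideal (I i) (J i)) ->
  exists g (deg : 'I_g -> 'I_r) (y : 'I_g -> R) (p : nat),
    (forall i, J i = var_span deg y predT i) /\
    (forall i, I i = var_span deg y (fun j => p <= j)%N i).
Proof.
move=> noethR idI idJ IJ.
have [sI IE] := fin_all_exists (fun i => ideal_fg noethR (idI i)).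
have [sJ JE] := fin_all_exists (fun i => ideal_fg noethR (idJ i)).
pose pairs (s : 'I_r -> seq R) := [seq (i, x) | i <- enum 'I_r, x <- s i].
have mem_pairs s i x : ((i, x) \in pairs s) = (x \in s i).
  apply/allpairsPdep/idP => [[k [z [_ zs [-> ->]]]]//|xs].
  by exists i, x; rewrite mem_enum.
pose ps := in_tuple (pairs sJ ++ pairs sI); pose p := size (pairs sJ).
exists (size ps), (fun j => (tnth ps j).1), (fun j => (tnth ps j).2), p.
have I_gen i : I i = var_span (fun j => (tnth ps j).1) (fun j => (tnth ps j).2)
                       (fun j => p <= j)%N i.
  rewrite IE; apply/seteqP; split; apply: span_mono => x.
    rewrite -(mem_pairs sI) => /(nthP (i, x))[k k_lt kE].
    have kp_lt : (p + k < size ps)%N by rewrite size_cat ltn_add2l.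
    have tnthE : tnth ps (Ordinal kp_lt) = (i, x).
      by rewrite (tnth_nth (i, x)) /= nth_cat ltnNge leq_addr /= addKn.
    by exists (Ordinal kp_lt); rewrite tnthE; split=> //; apply: leq_addr.
  move=> [j [pj <- ->]]; rewrite -mem_pairs -surjective_pairing (tnth_nth (tnth ps j)) /=.
  rewrite nth_cat ltnNge pj /= mem_nth // ltn_subLR // -size_cat.
  exact: ltn_ord.
split=> // i; apply/seteqP; split.
  rewrite JE; apply: span_mono => x; rewrite -(mem_pairs sJ) => x_in.
  have /tnthP[j jE] : (i, x) \in ps by rewrite mem_cat x_in.
  by exists j; rewrite -jE.
apply: span_min => // _ [j [_ <- ->]]; have := mem_tnth j ps.
rewrite mem_cat {1 2}[tnth ps j]surjective_pairing !mem_pairs => /orP[inJ|inI].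
  by rewrite JE; apply: mem_span.
by apply: IJ; rewrite IE; apply: mem_span.
Qed.

Section LeadingCoefficients.
Variables (R : comNzRingType) (g r : nat) (deg : 'I_g -> 'I_r) (y : 'I_g -> R).
Implicit Types (mu nu gam : 'X_{1..g}) (n : 'X_{1..r}) (B : 'X_{1..g} -> R -> Prop).

Definition coef_ideal B mu : R -> Prop := colon (B mu) (mmap1 y mu).

Definition trunc_stable c B := forall mu, sub_ideal (B mu) (B (mtrunc c mu)).

Lemma coef_ideal_mono B :
  (forall gam mu b, B mu b -> B (gam + mu)%MM (mmap1 y gam * b)) ->
  forall mu nu, (mu <= nu)%MM -> sub_ideal (coef_ideal B mu) (coef_ideal B nu).
Proof.
move=> shiftB mu nu /submK <- c Bc.
by rewrite /coef_ideal /colon mmap1_add mulrCA; apply: shiftB.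
Qed.

Lemma coef_ideal_stable B : noetherian R -> (forall mu, is_ideal (B mu)) ->
  (forall gam mu b, B mu b -> B (gam + mu)%MM (mmap1 y gam * b)) ->
  exists c, forall c', (c <= c')%N -> trunc_stable c' (coef_ideal B).
Proof.
move=> noethR idB shiftB.
have [mu|mu nu|c stable] := @monotone_ideals_stable R g (coef_ideal B) noethR.
- exact: colon_is_ideal.
- exact: coef_ideal_mono.
- by exists c => c' cc' mu; apply: stable.
Qed.

Variable P : 'X_{1..r} -> R -> Prop.
Hypothesis idP : forall n, is_ideal (P n).
Hypothesis shiftP : forall gam n x, P n x -> P (multideg deg gam + n)%MM (mmap1 y gam * x).

Definition lead_ideal mu := ideal_add (lower_span deg y mu) (P (multideg deg mu)).

Lemma lead_ideal_stable : noetherian R -> exists c, trunc_stable c (coef_ideal lead_ideal).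
Proof.
move=> noethR; have [mu||c stable] := @coef_ideal_stable lead_ideal noethR.
- exact: add_is_ideal.
- move=> gam mu _ [b [x [lower_b Px ->]]]; exists (mmap1 y gam * b), (mmap1 y gam * x).
  by rewrite mulrDr multidegD; split=> //; [apply: mem_lower_span_mul | apply: shiftP].
- by exists c; apply: stable.
Qed.

(* Elements of [P n] are reduced to zero by multiples of elements of [P] of bounded degree; this
   replaces the finite generation of [P] over the Rees algebra. *)
Lemma lead_reduction K n c : is_ideal K -> trunc_stable c (coef_ideal lead_ideal) ->
  (forall gam mu x, (forall j, (mu j <= c)%N) -> multideg deg (gam + mu)%MM = n ->
     P (multideg deg mu) x -> K (mmap1 y gam * x)) ->
  sub_ideal (P n `&` hom_span deg y predT n)%classic K.
Proof.
move=> idK stable genK.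
suff reduce mu d b : multideg deg mu = n -> lower_span deg y mu b ->
    P n (d * mmap1 y mu + b) -> K (d * mmap1 y mu + b).
  move=> x [Px /mon_span_lead[->|[mu [d [b [[_ mun] lower_b xE]]]]]]; first exact: ideal0.
  rewrite xE in Px *; apply: reduce => //; apply: mon_span_min lower_b => // nu.
  by case=> [[_ nun] nu_mu]; apply: mem_mon_span; rewrite nun.
move: mu d b; apply: ltmwf => mu IH d b mun lower_b Px; set tau := mtrunc c mu.
have [|b' [w [lower_b' Pw dE]]] := stable mu d.
  exists (- b), (d * mmap1 y mu + b); rewrite mun addrCA addNr addr0.
  by split=> //; apply: idealN.
pose gam := (mu - tau)%MM; have muE : mu = (gam + tau)%MM by rewrite submK ?mtrunc_le.
pose z := b + mmap1 y gam * b'.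
have xE : d * mmap1 y mu + b = mmap1 y gam * w + z.
  by rewrite muE mmap1_add mulrCA dE /z; ring.
have Kw : K (mmap1 y gam * w).
  by apply: genK Pw; rewrite -?muE // => j; rewrite mnmE geq_minr.
have Pz : P n z.
  have -> : z = d * mmap1 y mu + b - mmap1 y gam * w by rewrite xE addrC addKr.
  by apply: idealB => //; rewrite -mun muE multidegD; apply: shiftP.
have lower_z : lower_span deg y mu z.
  by apply: idealD => //; rewrite muE; apply: mem_lower_span_mul.
rewrite xE; apply: idealD => //.
have [->|[nu [e [z' [[nu_mu degnu] lower_z' zE]]]]] := mon_span_lead lower_z; first exact: ideal0.
rewrite zE in Pz *; apply: IH => //; first by rewrite degnu.
apply: mon_span_min lower_z' => // xi [[_ degxi] xi_nu]; apply: mem_mon_span.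
by rewrite degxi degnu.
Qed.

End LeadingCoefficients.

(** * The Artin-Rees lemma *)

Section ArtinRees.
Variables (R : comNzRingType) (m A : R -> Prop).
Hypotheses (noethR : noetherian R) (idm : is_ideal m) (idA : is_ideal A).
Implicit Types (n : 'X_{1..2}) (N s : nat).

Definition rees_ideal n := ideal_mul (ideal_exp m (n ord0)) (ideal_exp A (n ord_max)).

Lemma rees_ideal_add n n' : rees_ideal (n + n')%MM = ideal_mul (rees_ideal n) (rees_ideal n').
Proof. by rewrite /rees_ideal !mnmDE !ideal_expD // ideal_mulACA. Qed.

Lemma rees_ideal_prod n :
  ideal_prod_exp (fun i : 'I_2 => if i == ord0 then m else A) n = rees_ideal n.
Proof.
rewrite /ideal_prod_exp !enum_ordSl enum_ord0 /= (ideal_mulC (ideal_exp A _)) ideal_mul1 //.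
by rewrite /rees_ideal; congr (ideal_mul _ (ideal_exp A (n _))); apply: val_inj.
Qed.

Lemma rees_ideal_mul_exp n s z x : rees_ideal n z -> ideal_exp A s x ->
  ideal_mul (ideal_exp m (n ord0)) (ideal_exp A (n ord_max + s)) (z * x).
Proof. by move=> Wz Ax; rewrite ideal_expD // ideal_mulA //; apply: mem_ideal_mul. Qed.

Definition artin_rees_ideal n : R -> Prop :=
  (ideal_exp A (n ord_max).+1 `&` rees_ideal n)%classic.

Lemma artin_rees_ideal_is_ideal n : is_ideal (artin_rees_ideal n).
Proof. by apply: setI_is_ideal; rewrite /rees_ideal. Qed.

Lemma artin_rees_ideal_mul n n' z x : rees_ideal n z -> artin_rees_ideal n' x ->
  artin_rees_ideal (n + n')%MM (z * x).
Proof.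
move=> Wz [Ax Wx]; split; last by rewrite rees_ideal_add; apply: mem_ideal_mul.
rewrite mnmDE -addnS; apply: (@ideal_mul_subr _ (ideal_exp m (n ord0))) => //.
exact: rees_ideal_mul_exp.
Qed.

Lemma artin_rees_step : exists k, forall N s,
  sub_ideal (ideal_exp A s.+1 `&` ideal_mul (ideal_exp m N) (ideal_exp A s))%classic
            (ideal_mul (ideal_exp m (N - k)) (ideal_exp A s.+1)).
Proof.
pose F (i : 'I_2) := if i == ord0 then m else A.
have idF i : is_ideal (F i) by rewrite /F; case: ifP.
have [g [deg [y [_ [FE _]]]]] :=
  exists_generators noethR idF idF (fun i => @sub_ideal_refl _ (F i)).
have reesE n : hom_span deg y predT n = rees_ideal n.
  by rewrite -rees_ideal_prod (ideal_prod_exp_hom_span _ FE).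
have rees_mon gam : rees_ideal (multideg deg gam) (mmap1 y gam).
  by rewrite -reesE; apply: mem_mon_span; split=> //; apply/supportedP.
have shiftAR gam n x := @artin_rees_ideal_mul _ n _ x (rees_mon gam).
have [c stable] := lead_ideal_stable artin_rees_ideal_is_ideal shiftAR noethR.
exists (g * c)%N => N s x [Ax Wx]; pose n : 'X_{1..2} := [multinom [tuple N; s]].
apply: (lead_reduction artin_rees_ideal_is_ideal shiftAR (n := n) _ stable) => //.
  move=> gam mu z mu_le degE [Az _].
  have NE : N = (multideg deg gam ord0 + multideg deg mu ord0)%N.
    by rewrite -mnmDE -multidegD degE.
  have sE : s = (multideg deg gam ord_max + multideg deg mu ord_max)%N.
    by rewrite -mnmDE -multidegD degE.
  rewrite NE [in s.+1]sE -addnS.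
  apply: ideal_mul_mono (rees_ideal_mul_exp (rees_mon gam) Az) => //.
  apply: ideal_exp_anti => //; rewrite leq_subLR addnC leq_add2r.
  exact: leq_multideg.
by rewrite reesE.
Qed.

Lemma artin_rees : exists k, forall N s,
  sub_ideal (ideal_exp m N `&` ideal_exp A s)%classic
            (ideal_mul (ideal_exp m (N - k * s)) (ideal_exp A s)).
Proof.
have [k step] := artin_rees_step; exists k => N; elim=> [|s IH] x [mx Ax].
  by rewrite muln0 subn0 ideal_mulC ideal_mul1.
rewrite mulnS addnC subnDA; apply: step; split=> //; apply: IH; split=> //.
exact: (ideal_exp_anti idA (leqnSn s)).
Qed.

Lemma exp_setI_sub_exp B K : sub_ideal (ideal_mul (ideal_exp m K) A) B ->
  exists c, forall s,
    sub_ideal (ideal_exp A s `&` ideal_exp m (c * s))%classic (ideal_exp B s).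
Proof.
move=> mAB; have [k AR] := artin_rees; exists (K + k)%N => s.
rewrite setIC; apply: sub_ideal_trans (AR _ _) _.
rewrite -mulnBl addnK ideal_expM // -ideal_expMn //.
exact: ideal_exp_mono.
Qed.

End ArtinRees.

(** * The length of [J^n / I^n] *)

Definition mnm_cons g k (mu : 'X_{1..g}) : 'X_{1..g.+1} := [multinom [tuple of k :: mu]].

Fixpoint hom_monomials g r : ('I_g -> 'I_r) -> 'X_{1..r} -> seq 'X_{1..g} :=
  match g with
  | 0 => fun _ n => if n == 0%MM then [:: 0%MM] else [::]
  | g'.+1 => fun deg n =>
      [seq mnm_cons k mu | k <- iota 0 (n (deg ord0)).+1,
         mu <- hom_monomials (deg \o lift ord0) (n - U_(deg ord0) *+ k)%MM]
  end.

Section HomMonomials.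
Variable r : nat.
Implicit Types (g k : nat) (n : 'X_{1..r}).

Lemma mnm_cons0 g k (mu : 'X_{1..g}) : mnm_cons k mu ord0 = k.
Proof. by rewrite /mnm_cons multinomE tnth0. Qed.

Lemma mnm_consS g k (mu : 'X_{1..g}) j : mnm_cons k mu (lift ord0 j) = mu j.
Proof. by rewrite /mnm_cons multinomE tnthS. Qed.

Lemma mnm_cons_inj g : injective (fun kmu : nat * 'X_{1..g} => mnm_cons kmu.1 kmu.2).
Proof.
move=> [k mu] [l nu] /mnmP /= eq_cons; congr pair.
  by have := eq_cons ord0; rewrite !mnm_cons0.
by apply/mnmP => j; have := eq_cons (lift ord0 j); rewrite !mnm_consS.
Qed.

Lemma multideg_cons g (deg : 'I_g.+1 -> 'I_r) k (mu : 'X_{1..g}) :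
  multideg deg (mnm_cons k mu) = (U_(deg ord0) *+ k + multideg (deg \o lift ord0) mu)%MM.
Proof.
apply/mnmP => i; rewrite mnmDE mulmnE mnm1E !mnmE big_mkcond big_ord_recl mnm_cons0.
congr addn; first by case: eqP; rewrite ?mul1n.
by rewrite [RHS]big_mkcond; apply: eq_bigr => j _; rewrite mnm_consS.
Qed.

Lemma mem_hom_monomials g (deg : 'I_g -> 'I_r) n mu :
  (mu \in hom_monomials deg n) = (multideg deg mu == n).
Proof.
elim: g deg n mu => [|g IH] deg n mu.
  by rewrite nvar0_mnmE multideg0 eq_sym /=; case: eqP; rewrite ?inE ?eqxx.
apply/allpairsPdep/eqP => [[k [nu [+ + ->]]]|].
  rewrite mem_iota ltnS IH multideg_cons => kn /eqP->; rewrite addmC submK //.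
  apply/mnm_lepP => i; rewrite mulmnE mnm1E.
  by case: (deg ord0 =P i) => [<-|_]; rewrite ?mul1n.
case: mu => t; case/tupleP: t => k t; rewrite -/(mnm_cons k (Multinom t)) multideg_cons => degE.
exists k, (Multinom t); split=> //.
  by rewrite mem_iota ltnS -degE mnmDE mulmnE mnm1E eqxx mul1n leq_addr.
by rewrite IH -degE addmC addmK.
Qed.

Lemma sum_hom_monomials_recl g (deg : 'I_g.+1 -> 'I_r) n (phi : 'X_{1..g.+1} -> nat) :
  (\sum_(mu <- hom_monomials deg n) phi mu =
   \sum_(k < (n (deg ord0)).+1)
     \sum_(mu <- hom_monomials (deg \o lift ord0) (n - U_(deg ord0) *+ k)%MM)
       phi (mnm_cons k mu))%N.
Proof.
rewrite [LHS]big_allpairs_dep -[iota 0 _]/(index_iota 0 (n (deg ord0)).+1).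
exact: big_mkord.
Qed.

Lemma hom_monomials_uniq g (deg : 'I_g -> 'I_r) n : uniq (hom_monomials deg n).
Proof.
elim: g deg n => [|g IH] deg n; first by rewrite /=; case: eqP.
apply: allpairs_uniq_dep => [|k _|]; [exact: iota_uniq | exact: IH |].
by move=> [k mu] [l nu] _ _ /= /(@mnm_cons_inj g (k, mu) (l, nu))[-> ->].
Qed.

End HomMonomials.

Lemma length_mon_filtration (R : comNzRingType) g (y : 'I_g -> R) (Q : 'X_{1..g} -> Prop)
    (s : seq 'X_{1..g}) (h : 'X_{1..g} -> nat) :
  sorted <%O s ->
  (forall mu, mu \in s -> length_eq
     (colon (mon_span y (fun nu => Q nu \/ nu \in s /\ (nu < mu)%O)) (mmap1 y mu))
     (@unit_ideal R) (h mu)) ->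
  length_eq (mon_span y Q) (mon_span y (fun mu => Q mu \/ mu \in s)) (\sum_(mu <- s) h mu).
Proof.
elim/last_ind: s => [|s mu IH] s_sorted len_h.
  rewrite big_nil (@eq_mon_span _ _ _ (fun mu => Q mu \/ mu \in [::]) Q); last first.
    by move=> mu; rewrite in_nil; split=> [[]|] //; left.
  by split; [apply: has_chain_refl | apply: length_le_refl].
have lt_mu nu : nu \in s -> (nu < mu)%O.
  move: s_sorted; rewrite -cats1 sorted_pairwise; last exact: lt_trans.
  by rewrite pairwise_cat allrel1r => /and3P[/allP lt_mu _ _]; apply: lt_mu.
have memE nu : nu \in rcons s mu <-> nu \in s \/ nu = mu.
  by rewrite mem_rcons inE orbC; split=> [/orP[|/eqP]|[->|->]]; rewrite ?eqxx ?orbT; auto.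
rewrite -cats1 big_cat big_seq1 cats1.
have -> : mon_span y (fun nu => Q nu \/ nu \in rcons s mu) =
    adjoin (mon_span y (fun nu => Q nu \/ nu \in s)) (mmap1 y mu).
  by rewrite -mon_span_adjoin; apply: eq_mon_span => nu; rewrite memE; tauto.
apply: (@length_eqD _ _ (mon_span y (fun nu => Q nu \/ nu \in s))) => //.
- by apply: mon_span_min => // nu Qnu; apply: mem_mon_span; left.
- exact: sub_adjoin.
- apply: IH => [|nu snu].
    exact: (subseq_sorted (@lt_trans _ _) (subseq_rcons s mu) s_sorted).
  have := len_h nu; rewrite memE => /(_ (or_introl snu)); congr length_eq.
  congr colon; apply: eq_mon_span => xi; rewrite memE; split=> [[|[[|->]]]|[|[]]]; auto.
  by move=> mu_nu; have := lt_trans mu_nu (lt_mu _ snu); rewrite ltxx.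
- apply: length_eq_adjoin => //.
  have := len_h mu; rewrite memE => /(_ (or_intror erefl)); congr length_eq.
  congr colon; apply: eq_mon_span => nu; rewrite memE; split=> [[|[[|->]]]|[|snu]]; auto.
  by rewrite ltxx.
Qed.

Section GeneratorFiltration.
Variables (R : comNzRingType) (g r p : nat) (deg : 'I_g -> 'I_r) (y : 'I_g -> R).
Variables I J : 'I_r -> R -> Prop.
Implicit Types (mu nu : 'X_{1..g}) (n : 'X_{1..r}).
Hypothesis JE : forall i, J i = var_span deg y predT i.
Hypothesis IE : forall i, I i = var_span deg y (fun j => p <= j)%N i.

(* The monomials in the generators of the [I_i]. *)
Local Notation inner := (supported (fun j : 'I_g => p <= j)%N).

Lemma lt_inner mu nu : mdeg mu = mdeg nu -> inner mu -> ~~ inner nu -> (mu < nu)%O.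
Proof. by apply: lt_supported => j l; rewrite -ltnNge; apply: leq_trans. Qed.

(* Multiplying by [A] replaces a generator of some [J_i] by smaller generators, those of [I_i]. *)
Lemma sub_colon_lower_span A mu : (forall i, sub_ideal (ideal_mul A (J i)) (I i)) ->
  ~~ inner mu -> sub_ideal A (coef_ideal y (lower_span deg y) mu).
Proof.
move=> AJI; rewrite negb_forall => /existsP[j]; rewrite negb_imply => /andP[muj pj] a Aa.
have muE : mu = (mu - U_(j) + U_(j))%MM by rewrite submK ?lep1mP.
have Iay : I (deg j) (a * y j).
  by apply: AJI; apply: mem_ideal_mul => //; rewrite JE; apply: mem_span; exists j.
rewrite /coef_ideal /colon {2}muE mmap1_add mmap1U mulrCA mulrC.
suff: sub_ideal (I (deg j)) (colon (lower_span deg y mu) (mmap1 y (mu - U_(j)))) by apply.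
rewrite IE; apply: span_min => // _ [l [pl degl ->]].
rewrite /colon mulrC -(mmap1U y l) -mmap1_add; apply: mem_mon_span.
split; last by rewrite [in RHS]muE !multidegD !multidegU degl.
by rewrite [X in (_ < X)%O]muE ltmc_add2r; apply: lt_inner; rewrite ?mdeg1 ?supportedU.
Qed.

Lemma length_eq_prod_exp (h : 'X_{1..g} -> nat) n :
  (forall mu, ~~ inner mu ->
     length_eq (coef_ideal y (lower_span deg y) mu) (@unit_ideal R) (h mu)) ->
  length_eq (ideal_prod_exp I n) (ideal_prod_exp J n)
            (\sum_(mu <- hom_monomials deg n | ~~ inner mu) h mu).
Proof.
move=> len_h; pose s := sort <=%O [seq mu <- hom_monomials deg n | ~~ inner mu].
have s_mem mu : (mu \in s) = ~~ inner mu && (multideg deg mu == n).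
  by rewrite mem_sort mem_filter mem_hom_monomials.
have s_sorted : sorted <%O s.
  by rewrite sort_lt_sorted filter_uniq // hom_monomials_uniq.
rewrite -big_filter (perm_big s) /=; last by rewrite perm_sym perm_sort.
rewrite (ideal_prod_exp_hom_span _ IE) (ideal_prod_exp_hom_span _ JE) /hom_span.
rewrite (@eq_mon_span _ _ _ (fun mu => supported predT mu /\ _)
  (fun mu => (inner mu /\ multideg deg mu = n) \/ mu \in s)); last first.
  move=> mu; rewrite s_mem; split=> [[_ mun]|[[_ mun]|/andP[_ /eqP mun]]].
  - by have [mu_in|mu_out] := boolP (inner mu); [left | right; rewrite mun eqxx].
  - by split=> //; apply/supportedP.
  - by split=> //; apply/supportedP.
apply: length_mon_filtration => // mu; rewrite s_mem => /andP[mu_out /eqP mun].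
have := len_h mu mu_out; congr length_eq; congr (colon _ _); apply: eq_mon_span => nu.
rewrite s_mem mun; split=> [[nu_mu nun]|[[nu_in nun]|[/andP[_ /eqP nun] nu_mu]]] //.
  by have [nu_in|nu_out] := boolP (inner nu); [left | right; rewrite nun eqxx].
split=> //; apply: lt_inner => //.
by rewrite -(mdeg_multideg deg) nun -mun mdeg_multideg.
Qed.

End GeneratorFiltration.

Section ProductsOfPowers.
Variables (R : comNzRingType) (r : nat).
Implicit Types (A : R -> Prop) (I J : 'I_r -> R -> Prop) (n : 'I_r -> nat).

Definition seq_prod_exp (t : seq 'I_r) I n : R -> Prop :=
  foldr (fun i => ideal_mul (ideal_exp (I i) (n i))) (@unit_ideal R) t.

Lemma seq_prod_exp_is_ideal t I n : (forall i, is_ideal (I i)) -> is_ideal (seq_prod_exp t I n).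
Proof. by case: t => //= i t. Qed.

Lemma prod_exp_is_ideal I n : (forall i, is_ideal (I i)) -> is_ideal (ideal_prod_exp I n).
Proof. exact: seq_prod_exp_is_ideal. Qed.

Lemma ideal_prod_expM I n s : (forall i, is_ideal (I i)) ->
  ideal_prod_exp I (fun i => n i * s)%N = ideal_exp (ideal_prod_exp I n) s.
Proof.
move=> idI; rewrite -[LHS]/(seq_prod_exp _ _ _) -[X in ideal_exp X]/(seq_prod_exp _ _ _).
elim: (enum 'I_r) => [|i t IH] /=; first by rewrite ideal_exp_unit.
by rewrite IH ideal_expMn ?ideal_expM //; apply: seq_prod_exp_is_ideal.
Qed.

Lemma ideal_exp_mul_prod_exp A I J n : is_ideal A ->
  (forall i, is_ideal (J i)) -> (forall i, sub_ideal (ideal_mul A (J i)) (I i)) ->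
  sub_ideal (ideal_mul (ideal_exp A (\sum_i n i)) (ideal_prod_exp J n)) (ideal_prod_exp I n).
Proof.
move=> idA idJ AJI; rewrite -big_enum -[ideal_prod_exp J n]/(seq_prod_exp _ _ _).
rewrite -[ideal_prod_exp I n]/(seq_prod_exp _ _ _).
elim: (enum 'I_r) => [|i t IH]; first by rewrite big_nil ideal_mul1.
have idJt := seq_prod_exp_is_ideal t n idJ.
rewrite big_cons /= ideal_expD // ideal_mulACA // -ideal_expMn //.
by apply: ideal_mul_mono IH; apply: ideal_exp_mono.
Qed.

End ProductsOfPowers.

Section FiniteColength.
Variables (R : comNzRingType) (m : R -> Prop) (r : nat) (I J : 'I_r -> R -> Prop).
Hypotheses (noethR : noetherian R) (maxm : maximal_ideal m).
Hypothesis uniqm : forall M, maximal_ideal M -> forall x, M x <-> m x.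
Hypotheses (idI : forall i, is_ideal (I i)) (idJ : forall i, is_ideal (J i)).
Hypothesis IJ : forall i, sub_ideal (I i) (J i).
Hypothesis lenIJ : forall i, exists l, length_eq (I i) (J i) l.

Let idm : is_ideal m := maximal_is_ideal maxm.

Lemma maximal_exp_mul_sub_uniform :
  exists K, forall i, sub_ideal (ideal_mul (ideal_exp m K) (J i)) (I i).
Proof.
have [l len_l] := fin_all_exists lenIJ; exists (\sum_i l i)%N => i; have [_ leni] := len_l i.
apply: sub_ideal_trans (maximal_exp_mul_sub noethR maxm uniqm (idI i) (idJ i) (@IJ i) leni).
apply: ideal_mul_mono => //; apply: ideal_exp_anti => //.
by rewrite (bigD1 i) //= leq_addr.
Qed.

Lemma length_prod_exp_formula :
  exists g (deg : 'I_g -> 'I_r) (phi : 'X_{1..g} -> nat) (c : nat),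
    (forall mu, phi (mtrunc c mu) = phi mu) /\
    forall n : 'X_{1..r}, length_eq (ideal_prod_exp I n) (ideal_prod_exp J n)
                            (\sum_(mu <- hom_monomials deg n) phi mu).
Proof.
have [g [deg [y [p [JE IE]]]]] := exists_generators noethR idI idJ IJ.
pose L := coef_ideal y (lower_span deg y).
pose inner := supported (fun j : 'I_g => p <= j)%N.
pose h mu := get (length_eq (L mu) (@unit_ideal R)).
have [K mK] := maximal_exp_mul_sub_uniform.
have len_h mu : ~~ inner mu -> length_eq (L mu) (@unit_ideal R) (h mu).
  move=> mu_out; have [k lenK] := colength_le_maximal_exp noethR maxm K.
  apply: (getPex (P := length_eq (L mu) (@unit_ideal R))).
  apply: (@length_le_length_eq _ _ _ k) => //; first exact: colon_is_ideal.
  exact: colength_le_mono (sub_colon_lower_span JE IE mK mu_out) lenK.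
have shift_lower gam mu b := @mem_lower_span_mul _ _ _ deg y gam mu b.
have [|c stable] := coef_ideal_stable noethR _ shift_lower => //.
exists g, deg, (fun mu => if inner mu then 0%N else h mu), c.+1; split=> [mu|n].
  have -> : inner (mtrunc c.+1 mu) = inner mu.
    by apply: eq_forallb => j; rewrite mnmE; case: (mu j) => // k; rewrite minnSS.
  suff -> : h (mtrunc c.+1 mu) = h mu by [].
  rewrite /h; suff -> : L (mtrunc c.+1 mu) = L mu by [].
  apply/seteqP; split; last exact: stable (leqnSn c) mu.
  exact: (coef_ideal_mono shift_lower (mtrunc_le _ _)).
rewrite (eq_bigr (fun mu => if ~~ inner mu then h mu else 0%N)); last by move=> mu _; case: ifP.
by rewrite -big_mkcond; apply: length_eq_prod_exp JE IE _ _ len_h.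
Qed.

Lemma length_prod_exp_diagonal_growth d : ~ has_prime_chain R d.+1 ->
  exists C, forall s l,
    length_eq (ideal_prod_exp I (fun=> s)) (ideal_prod_exp J (fun=> s)) l -> (l <= C * s ^ d)%N.
Proof.
move=> nochain; have [k growth] := colength_maximal_exp_growth noethR maxm uniqm nochain.
have [K mK] := maximal_exp_mul_sub_uniform.
have := ideal_exp_mul_prod_exp (n := fun=> 1%N) (exp_is_ideal K idm) idJ mK.
rewrite -ideal_expM // => mKJI.
have [c mcJI] := exp_setI_sub_exp noethR idm (prod_exp_is_ideal _ idJ) mKJI.
exists (c ^ d * k)%N => s l; have s1 : (fun=> s) = (fun i : 'I_r => 1 * s)%N.
  by apply: funext => i; rewrite mul1n.
rewrite s1 !ideal_prod_expM // => -[chainl _]; rewrite mulnAC -expnMn.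
by apply: has_chain_length_le chainl _; apply: colength_le_setI (mcJI s) (growth _).
Qed.

End FiniteColength.

(** * Numerical polynomials *)

Section FiniteDifferences.
Implicit Types (f : nat -> int) (b c k n : nat).

Definition fdiff f n : int := f n.+1 - f n.

Definition eventually_poly f := exists D N, forall n, (N <= n)%N -> iter D fdiff f n = 0.

Lemma eventually_poly_shift f f' b : (forall n, (b <= n)%N -> f' n = f (n - b)%N) ->
  eventually_poly f -> eventually_poly f'.
Proof.
move=> f'E [D [N fD0]]; exists D, (b + N)%N => n bNn.
suff -> : iter D fdiff f' n = iter D fdiff f (n - b)%N by apply: fD0; rewrite leq_subRL //; lia.
elim: D {fD0} n {bNn} (leq_trans (leq_addr N b) bNn) => [|D IH] n bn; first exact: f'E.
by rewrite /= /fdiff !IH ?subSn // leqW.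
Qed.

Lemma eventually_poly_sum f : eventually_poly f -> eventually_poly (fun n => \sum_(j < n.+1) f j).
Proof.
move=> [D [N fD0]]; exists D.+1, N => n Nn; set S := (fun n => _).
suff -> : iter D.+1 fdiff S n = iter D fdiff f n.+1 by apply/fD0/leqW.
rewrite iterSr; elim: D {fD0} n {Nn} => [|D IH] n /=; last by rewrite /fdiff !IH.
by rewrite /fdiff /S big_ord_recr /= addrAC subrr add0r.
Qed.

Lemma eventually_poly_binomial f : eventually_poly f -> exists (a : seq int) N,
  forall n, (N <= n)%N -> f n = \sum_(k < size a) a`_k * ('C(n, k))%:Z.
Proof.
move=> [D]; elim: D f => [|D IH] f [N fD0].
  by exists [::], N => n /fD0; rewrite big_ord0.
have [|a [M fdiffE]] := IH (fdiff f); first by exists N => n /fD0; rewrite iterSr.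
pose rest n := f n - \sum_(k < size a) a`_k * ('C(n, k.+1))%:Z.
have pascal n : \sum_(k < size a) a`_k * ('C(n.+1, k.+1))%:Z =
    \sum_(k < size a) a`_k * ('C(n, k))%:Z + \sum_(k < size a) a`_k * ('C(n, k.+1))%:Z.
  by rewrite -big_split; apply: eq_bigr => k _; rewrite binS PoszD mulrDr addrC.
have rest_const n : rest (M + n)%N = rest M.
  elim: n => [|n IHn]; first by rewrite addn0.
  have /eqP := fdiffE (M + n)%N (leq_addr _ _).
  rewrite -{}IHn /rest /fdiff subr_eq addnS => /eqP->.
  by rewrite pascal; ring.
exists (rest M :: a), M => n Mn.
by rewrite big_ord_recl bin0 mulr1 -(rest_const (n - M)%N) subnKC // /rest subrK.
Qed.

Fixpoint binomial_poly k : {poly rat} :=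
  if k is l.+1 then l.+1%:R^-1 *: (binomial_poly l * ('X - l%:R%:P)) else 1.

Lemma binomial_polyS k x :
  k.+1%:R * (binomial_poly k.+1).[x] = (binomial_poly k).[x] * (x - k%:R).
Proof. by rewrite hornerZ hornerM hornerXsubC mulVKf // pnatr_eq0. Qed.

Lemma horner_binomial_poly k n : (binomial_poly k).[n%:R] = ('C(n, k))%:R.
Proof.
elim: k => [|k IH]; first by rewrite hornerC bin0.
apply: (mulfI (x := k.+1%:R)); first by rewrite pnatr_eq0.
rewrite binomial_polyS IH -natrM mul_bin_left.
have [kn|nk] := leqP k n; first by rewrite natrM natrB // mulrC.
by rewrite bin_small // mul0r muln0.
Qed.

Lemma horner_binomial_polyN k n :
  (binomial_poly k).[- n.+1%:R] = (-1) ^+ k * ('C(n + k, k))%:R.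
Proof.
elim: k => [|k IH]; first by rewrite hornerC bin0 mulr1.
apply: (mulfI (x := k.+1%:R)); first by rewrite pnatr_eq0.
rewrite binomial_polyS IH mulrCA -natrM -mul_bin_diag addnS natrM exprS.
by rewrite -!addSn natrD; ring.
Qed.

Lemma horner_binomial_poly_int k (z : int) : (binomial_poly k).[z%:~R] \is a Num.int.
Proof.
case: z => n; first by rewrite -pmulrn horner_binomial_poly.
rewrite NegzE mulrNz -pmulrn horner_binomial_polyN.
by rewrite rpredM ?rpredX ?rpredN ?rpred1 ?rpred_nat.
Qed.

Lemma eventually_poly_numerical f : eventually_poly f -> exists p : {poly rat},
  (forall z : int, p.[z%:~R] \is a Num.int) /\
  exists N, forall n, (N <= n)%N -> (f n)%:~R = p.[n%:R].
Proof.
move=> /eventually_poly_binomial[a [N fE]].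
exists (\sum_(k < size a) (a`_k)%:~R *: binomial_poly k); split=> [z|].
  rewrite horner_sum rpred_sum // => k _; rewrite hornerZ rpredM ?intr_int //.
  exact: horner_binomial_poly_int.
exists N => n /fE->; rewrite horner_sum rmorph_sum; apply: eq_bigr => k _ /=.
by rewrite hornerZ horner_binomial_poly intrM.
Qed.

Lemma eventually_poly_cell_sum f b c : eventually_poly f ->
  eventually_poly (fun n => \sum_(k < n.+1 | minn k c == b) f (n - k)%N).
Proof.
move=> f_poly; have [bc|cb|->] := ltngtP b c.
- apply: (eventually_poly_shift (f := f) (b := b)) => // n bn.
  rewrite (big_pred1 (Ordinal (bn : (b < n.+1)%N))) // => k /=.
  by rewrite -val_eqE /= minnE; apply/eqP/eqP; lia.
- exists 0%N, 0%N => n _ /=; rewrite big_pred0 // => k; apply/eqP; lia.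
- apply: (eventually_poly_shift (b := c) _ (eventually_poly_sum f_poly)) => n cn.
  rewrite (reindex_inj rev_ord_inj) (big_ord_widen n.+1) ?ltnS ?leq_subr //.
  apply: eq_big => [k|k _] /=; last by congr f; have := ltn_ord k; lia.
  by have := ltn_ord k; lia.
Qed.

End FiniteDifferences.

Lemma lead_coef_le_horner_nat (F : archiRealFieldType) (p : {poly F}) : 0 < lead_coef p ->
  exists N, forall n, (N <= n)%N -> lead_coef p <= p.[n%:R].
Proof.
move=> /poly_pinfty_gt_lc[x p_ge]; exists (Num.bound `|x|) => n xn; apply: p_ge.
apply: le_trans (ler_norm x) (ltW (lt_le_trans (archi_boundP (normr_ge0 x)) _)).
by rewrite ler_nat.
Qed.

Lemma size_poly_growth (F : archiRealFieldType) (p : {poly F}) C d N :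
  (forall n, (N <= n)%N -> 0 <= p.[n%:R] <= C * n%:R ^+ d) -> (size p <= d.+1)%N.
Proof.
move=> p_growth; rewrite leqNgt; apply/negP => size_p.
have not_pos (q : {poly F}) : 0 < lead_coef q -> (forall n, (N <= n)%N -> q.[n%:R] <= 0) -> False.
  move=> lq_gt0 q_le0; have [M q_ge] := lead_coef_le_horner_nat lq_gt0.
  have := le_trans (q_ge _ (leq_maxr N M)) (q_le0 _ (leq_maxl N M)).
  by rewrite leNgt lq_gt0.
have [lp|lp|/eqP] := ltrgtP (lead_coef p) 0.
- apply: (not_pos (- p)) => [|n /p_growth/andP[p_ge0 _]]; first by rewrite lead_coefN oppr_gt0.
  by rewrite hornerN oppr_le0.
- apply: (not_pos (p - C *: 'X^d)) => [|n /p_growth/andP[_ p_le]].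
    by rewrite lead_coefDl // size_polyN (leq_ltn_trans (size_scale_leq _ _)) ?size_polyXn.
  by rewrite hornerD hornerN hornerZ hornerXn subr_le0.
- by rewrite lead_coef_eq0 -size_poly_eq0 => /eqP size0; rewrite size0 in size_p.
Qed.

Section ProductSums.
Variable r : nat.
Implicit Types (H : 'X_{1..r} -> nat) (n : 'X_{1..r}).

(* The factors are [nat]-valued, so that a bound on the sum bounds each product. *)
Inductive product_sum : ('X_{1..r} -> nat) -> Prop :=
| product_sum0 : product_sum (fun=> 0%N)
| product_sumD (f : 'I_r -> nat -> nat) H :
    (forall i, eventually_poly (fun k => (f i k)%:Z)) -> product_sum H ->
    product_sum (fun n => \prod_i f i (n i) + H n)%N.

Lemma product_sum_ext H H' : H =1 H' -> product_sum H -> product_sum H'.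
Proof. by move=> /funext->. Qed.

Lemma product_sum_add H H' : product_sum H -> product_sum H' ->
  product_sum (fun n => H n + H' n)%N.
Proof.
move=> + sumH'; elim=> [|f H1 f_poly _ IH]; first exact: product_sum_ext sumH'.
by apply: product_sum_ext (product_sumD f_poly IH) => n; rewrite addnA.
Qed.

Lemma product_sum_sum c (H : nat -> 'X_{1..r} -> nat) : (forall b, product_sum (H b)) ->
  product_sum (fun n => \sum_(b < c) H b n)%N.
Proof.
move=> sumH; elim: c => [|c IH].
  by apply: product_sum_ext product_sum0 => n; rewrite big_ord0.
by apply: product_sum_ext (product_sum_add IH (sumH c)) => n; rewrite big_ord_recr.
Qed.

Lemma product_sum_cell_sum i0 b c H : product_sum H -> product_sum (fun n =>
  \sum_(k < (n i0).+1 | minn k c == b) H (n - U_(i0) *+ k)%MM)%N.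
Proof.
elim=> [|f H1 f_poly _ IH]; first by apply: product_sum_ext product_sum0 => n; rewrite big1.
pose f' i k := if i0 == i then (\sum_(j < k.+1 | minn j c == b) f i (k - j))%N else f i k.
have f'_poly i : eventually_poly (fun k => (f' i k)%:Z).
  rewrite /f'; case: eqP => // _.
  apply: (eventually_poly_shift (b := 0%N)) (eventually_poly_cell_sum b c (f_poly i)) => k _.
  by rewrite subn0 (big_morph Posz PoszD (erefl _)).
apply: product_sum_ext (product_sumD f'_poly IH) => n /=; rewrite big_split; congr addn.
rewrite (bigD1 i0) //= {1}/f' eqxx big_distrl; apply: eq_bigr => k _.
rewrite [RHS](bigD1 i0) //= mnmBE mulmnE mnm1E eqxx mul1n; congr muln.
apply: eq_bigr => i; rewrite eq_sym /f' mnmBE mulmnE mnm1E => /negPf->.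
by rewrite mul0n subn0.
Qed.

Lemma product_sum_at0 a : product_sum (fun n => (n == 0%MM) * a)%N.
Proof.
have prodE n : (\prod_i (n i == 0) = (n == 0%MM))%N.
  case: eqP => [->|n_neq0]; first by rewrite big1 // => i _; rewrite mnm0E.
  have /existsNP[i /eqP/negPf ni] : ~ forall i, n i = 0%N.
    by move=> n0; apply: n_neq0; apply/mnmP => i; rewrite mnm0E.
  by rewrite (bigD1 i) //= ni.
elim: a => [|a IH]; first by apply: product_sum_ext product_sum0 => n; rewrite muln0.
apply: product_sum_ext (product_sumD (f := fun _ k => k == 0%N) _ IH) => [n|_].
  by rewrite prodE mulnS.
by exists 0%N, 1%N => -[].
Qed.

Lemma mtrunc_cons g c k (mu : 'X_{1..g}) :
  mtrunc c (mnm_cons k mu) = mnm_cons (minn k c) (mtrunc c mu).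
Proof.
apply/mnmP => i; rewrite mnmE.
by case: (unliftP ord0 i) => [j|] ->; rewrite ?mnm_consS ?mnm_cons0 ?mnmE.
Qed.

Lemma product_sum_hom_monomials g (deg : 'I_g -> 'I_r) (phi : 'X_{1..g} -> nat) c :
  (forall mu, phi (mtrunc c mu) = phi mu) ->
  product_sum (fun n => \sum_(mu <- hom_monomials deg n) phi mu)%N.
Proof.
elim: g deg phi => [|g IH] deg phi phi_trunc.
  apply: product_sum_ext (product_sum_at0 (phi 0%MM)) => n /=.
  by case: eqP; rewrite ?big_seq1 ?big_nil ?mul1n.
pose H b n := (\sum_(mu <- hom_monomials (deg \o lift ord0) n) phi (mnm_cons b mu))%N.
have sumH b : product_sum (H b).
  by apply: IH => mu; rewrite -phi_trunc -[RHS]phi_trunc !mtrunc_cons mtruncK.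
apply: product_sum_ext
  (product_sum_sum c.+1 (fun b => product_sum_cell_sum (deg ord0) b c (sumH b))) => n.
rewrite sum_hom_monomials_recl (exchange_big_dep xpredT) //=.
apply: eq_bigr => k _; have kc : (minn k c < c.+1)%N by rewrite ltnS geq_minr.
rewrite (big_pred1 (Ordinal kc)) => [|b]; last exact: eq_sym.
apply: eq_bigr => mu _; rewrite -phi_trunc -[RHS]phi_trunc !mtrunc_cons.
by rewrite -minnA minnn.
Qed.

Definition mpoly_at (p : {poly rat}) (i : 'I_r) : {mpoly rat[r]} :=
  \sum_(k < size p) p`_k *: 'X_i ^+ k.

Lemma meval_mpoly_at p i v : (mpoly_at p i).@[v] = p.[v i].
Proof.
rewrite /mpoly_at horner_coef raddf_sum; apply: eq_bigr => k _ /=.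
by rewrite mevalZ rmorphXn /= mevalXU.
Qed.

Lemma msize_mpoly_at p i : (msize (mpoly_at p i) <= size p)%N.
Proof.
apply: leq_trans (mmeasure_sum _ _ _ _) _; apply/bigmax_leqP => k _.
apply: leq_trans (msizeZ_le _ _) _.
by rewrite mpolyXn msizeX mdegMn mdeg1 mul1n.
Qed.

Lemma msize_prod_mpoly_at (p : 'I_r -> {poly rat}) :
  (msize (\prod_i mpoly_at (p i) i)%R <= size (\prod_i p i)%R)%N.
Proof.
have [/forallP p_neq0|] := boolP [forall i, p i != 0]; last first.
  rewrite negb_forall => /existsP[i /negPn/eqP pi0].
  by rewrite (bigD1 i) //= pi0 {1}/mpoly_at size_poly0 big_ord0 mul0r msize0.
suff [] : (msize (\prod_i mpoly_at (p i) i)%R <= size (\prod_i p i)%R)%N /\ \prod_i p i != 0 by [].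
apply: (big_ind2 (fun (F : {mpoly rat[r]}) (q : {poly rat}) => (msize F <= size q)%N /\ q != 0)).
- by rewrite msize1 size_poly1 oner_eq0.
- move=> F q F' q' [Fq q_neq0] [Fq' q'_neq0]; split; last by rewrite mulf_neq0.
  have [->|F_neq0] := eqVneq F 0; first by rewrite mul0r msize0.
  have [->|F'_neq0] := eqVneq F' 0; first by rewrite mulr0 msize0.
  by rewrite msizeM // size_mul // -!subn1 leq_sub2r // leq_add.
- by move=> i _; split; [apply: msize_mpoly_at | apply: p_neq0].
Qed.

Lemma prod_eventually_poly (f : 'I_r -> nat -> nat) :
  (forall i, eventually_poly (fun k => (f i k)%:Z)) -> exists p : 'I_r -> {poly rat},
  (forall i (z : int), (p i).[z%:~R] \is a Num.int) /\
  exists N, forall n : 'I_r -> nat, (forall i, (N <= n i)%N) ->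
    (\prod_i f i (n i))%:R = \prod_i (p i).[(n i)%:R].
Proof.
move=> f_poly; have [p pP] := fin_all_exists (fun i => eventually_poly_numerical (f_poly i)).
have [N fE] := fin_all_exists (fun i => proj2 (pP i)).
exists p; split=> [i|]; first by case: (pP i).
exists (\max_i N i)%N => n Nn; rewrite natr_prod; apply: eq_bigr => i _; rewrite -fE //.
by apply: leq_trans (Nn i); apply: leq_bigmax.
Qed.

Lemma product_sum_numerical_poly C d H : product_sum H ->
  (forall s, (H [multinom s | _ < r] <= C * s ^ d)%N) ->
  exists F : {mpoly rat[r]}, numerical_poly F /\ (msize F <= d.+1)%N /\
    exists N, forall n, (forall i, (N <= n i)%N) -> (H n)%:R = F.@[fun i => (n i)%:R].
Proof.
elim=> [_|f H1 f_poly _ IH growth].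
  exists 0; rewrite msize0; split=> [z|]; first by rewrite meval0.
  by split=> //; exists 0%N => n _; rewrite meval0.
have [s|F [F_num [F_size [N F_eval]]]] := IH; first exact: leq_trans (leq_addl _ _) (growth s).
have [p [p_int [M p_eval]]] := prod_eventually_poly f_poly.
exists (\prod_i mpoly_at (p i) i + F); split; [|split].
- move=> z; rewrite mevalD rpredD ?F_num // rmorph_prod rpred_prod // => i _.
  by rewrite /= meval_mpoly_at.
- apply: leq_trans (msizeD_le _ _) _; rewrite geq_max F_size andbT.
  apply: leq_trans (msize_prod_mpoly_at p) _.
  apply: (@size_poly_growth _ _ C%:R _ M) => s Ms; rewrite horner_prod -(p_eval (fun=> s)) //.
  rewrite ler0n -natrX -natrM ler_nat; apply: leq_trans (growth s).
  have -> : (\prod_i f i s = \prod_i f i ([multinom s | _ < r] i))%N.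
    by apply: eq_bigr => i _; rewrite mnmE.
  exact: leq_addr.
- exists (maxn M N) => n n_ge; rewrite natrD mevalD; congr (_ + _); last first.
    by apply: F_eval => i; apply: leq_trans (leq_maxr M N) (n_ge i).
  rewrite p_eval => [|i]; last exact: leq_trans (leq_maxl M N) (n_ge i).
  by rewrite rmorph_prod; apply: eq_bigr => i _ /=; rewrite meval_mpoly_at.
Qed.

End ProductSums.

Theorem theorem5p3 (R : comNzRingType) (d r : nat) (I J : 'I_r -> R -> Prop) :
  noetherian R -> local_ring R -> krull_dim R d ->
  (forall i, is_ideal (I i)) -> (forall i, is_ideal (J i)) ->
  (forall i, sub_ideal (I i) (J i)) ->
  (forall i, exists l, length_eq (I i) (J i) l) ->
  exists F : {mpoly rat[r]},
    numerical_poly F /\ (msize F <= d.+1)%N /\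
    exists N : nat, forall n : 'I_r -> nat, (forall i, (N <= n i)%N) ->
      exists l : nat,
        length_eq (ideal_prod_exp I n) (ideal_prod_exp J n) l /\
        (l%:R : rat) = F.@[fun i => (n i)%:R].
Proof.
move=> noethR [m [maxm uniqm]] [_ nochain] idI idJ IJ lenIJ.
have [g [deg [phi [c [phi_trunc len]]]]] :=
  length_prod_exp_formula noethR maxm uniqm idI idJ IJ lenIJ.
have [C growth] := length_prod_exp_diagonal_growth noethR maxm uniqm idI idJ IJ lenIJ nochain.
have multinomK (n : 'I_r -> nat) : [multinom n i | i < r] = n :> ('I_r -> nat).
  by apply: funext => i; rewrite mnmE.
have [s|F [F_num [F_size [N F_eval]]]] :=
  @product_sum_numerical_poly r C d _ (product_sum_hom_monomials deg phi_trunc).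
  by apply: growth; have := len [multinom s | _ < r]; rewrite multinomK.
exists F; do 2!split=> //; exists N => n n_ge; pose nu := [multinom n i | i < r].
exists (\sum_(mu <- hom_monomials deg nu) phi mu)%N; rewrite -(multinomK n).
by split; [apply: len | apply: F_eval => i; rewrite multinomK].
Qed.
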